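(* Let $X$ be an involutive commutative Hausdorff topological two-valued group containing at least one element whose order is neither $1$, nor $2$, nor $4$. Then $X$ is isomorphic to a coset topological two-valued group of the form $X^{\mathbf a}_A=A/\iota_{\mathbf a}$, where $A$ is a commutative Hausdorff topological group and $\iota_{\mathbf a}(a)=a^{-1}$ is the antipodal involution on $A$.
   Context: For a set $X$, $\mathrm{Sym}^2(X)$ is the set of two-element multisets $[x,y]$ of elements of $X$. A two-valued group is a set $X$ with a map $*\colon X\times X\to \mathrm{Sym}^2(X)$, an element $e\in X$ and a map $x\mapsto x^{-1}$ such that: (associativity) $x*(y*z)=(x*y)*z$ as four-element multisets, where $x*[u,v]$ is the multiset union of $x*u$ and $x*v$, and similarly for $[u,v]*z$; (strong identity) $e*x=x*e=[x,x]$; (existence and uniqueness of inverse) $e$ belongs to each of $x*x^{-1}$ and $x^{-1}*x$, and if $e$ belongs to $x*y$ or to $y*x$ then $y=x^{-1}$. It is commutative if $x*y=y*x$ for all $x,y$, and involutive if $x^{-1}=x$ for all $x$. A topological two-valued group is a topological space $X$ with a two-valued group structure such that $*\colon X\times X\to\mathrm{Sym}^2(X)$ and $x\mapsto x^{-1}$ are continuous, where $\mathrm{Sym}^2(X)$ has the quotient topology from $X\times X$. An isomorphism of topological two-valued groups is a homeomorphism $f$ such that $x*y=[z_1,z_2]$ implies $f(x)*f(y)=[f(z_1),f(z_2)]$. For an element $x$ of an involutive two-valued group there is a unique sequence $x^0=e,\ x^1=x,\ x^2,\ldots$ with $x*x^k=x^k*x=[x^{k-1},x^{k+1}]$ for all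 $k\ge1$. The order $\mathrm{ord}\,x$ is the least positive integer $k$ with $x^k=e$, and $\infty$ if there is none. Coset construction: if $G$ is a topological group and $\iota$ a continuous automorphism of $G$ with $\iota^2=\mathrm{id}$, then $G/\iota$ denotes the set of orbits of $\iota$ with quotient topology and $\pi(g)*\pi(h)=[\pi(gh),\pi(g\iota(h))]$, identity $\pi(e)$ and inverse $\pi(g)^{-1}=\pi(g^{-1})$, where $\pi\colon G\to G/\iota$ is the projection. *)

(* Defs.v *)
From HB Require Import structures.
From mathcomp Require Import all_boot all_order all_algebra.
From mathcomp Require Import all_classical all_reals all_analysis.

Set Implicit Arguments.
Unset Strict Implicit.
Unset Printing Implicit Defensive.

Import GRing.Theory.
Local Open Scope classical_set_scope.
Local Open Scope quotient_scope.

Section UnorderedPairs.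
Variable X : choiceType.

Definition swap_rel : rel (X * X) :=
  fun p q => (q == p) || (q == (p.2, p.1)).

Lemma swap_rel_refl : reflexive swap_rel.
Proof. by move=> p; rewrite /swap_rel eqxx. Qed.

Lemma swap_rel_sym : symmetric swap_rel.
Proof.
move=> [a b] [c d]; rewrite /swap_rel /= !xpair_eqE (eq_sym c a) (eq_sym d b).
by rewrite (eq_sym c b) (eq_sym d a) [(b == c) && _]andbC.
Qed.

Lemma swap_rel_trans : transitive swap_rel.
Proof.
move=> [a b] [c d] [x y] /orP[|] /eqP[-> ->] // /orP[|] /eqP[-> ->];
  by rewrite /swap_rel /= !eqxx ?orbT.
Qed.

Canonical swap_equiv :=
  EquivRel swap_rel swap_rel_refl swap_rel_sym swap_rel_trans.

Definition Sym2 : Type := {eq_quot swap_equiv}.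
HB.instance Definition _ := Quotient.on Sym2.
HB.instance Definition _ := [Sub Sym2 of X * X by %/].
HB.instance Definition _ := [Choice of Sym2 by <:].

Definition sym2 (x y : X) : Sym2 := \pi_Sym2 (x, y).

(* The elements of an unordered pair, with multiplicity; meaningful up to
   [perm_eq] only, see [elts_sym2] and [eltsP]. *)
Definition elts (p : Sym2) : seq X := [:: (repr p).1; (repr p).2].

Lemma eq_sym2 a b c d :
  (sym2 a b == sym2 c d) = ((a, b) == (c, d)) || ((a, b) == (d, c)).
Proof.
have -> : ((a, b) == (c, d)) || ((a, b) == (d, c)) = swap_rel (a, b) (c, d).
  by rewrite swap_rel_sym.
by apply/eqP/idP => [|h];
  [move/(@eqmodP _ swap_equiv)|exact/(@eqmodP _ swap_equiv)].
Qed.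

Lemma sym2C a b : sym2 a b = sym2 b a.
Proof. by apply/eqP; rewrite eq_sym2 eqxx orbT. Qed.

Lemma sym2_repr p : p = sym2 (repr p).1 (repr p).2.
Proof. by rewrite /sym2 -surjective_pairing reprK. Qed.

Lemma sym2_ind (P : Sym2 -> Prop) : (forall a b, P (sym2 a b)) -> forall p, P p.
Proof. by move=> h p; rewrite (sym2_repr p). Qed.

Lemma elts_sym2 a b : perm_eq (elts (sym2 a b)) [:: a; b].
Proof.
have := sym2_repr (sym2 a b); rewrite /elts.
case: (repr (sym2 a b)) => c d /= /eqP; rewrite eq_sym2 => /orP[] /eqP[-> ->] //.
exact: permEl (perm_catC [:: _] [:: _]).
Qed.

Lemma eltsP p q : reflect (p = q) (perm_eq (elts p) (elts q)).
Proof.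
apply: (iffP idP) => [|-> //]; elim/sym2_ind: p => a b; elim/sym2_ind: q => c d.
rewrite (permPl (elts_sym2 a b)) (permPr (elts_sym2 c d)) => h.
have : a \in [:: c; d] by rewrite -(perm_mem h) mem_head.
rewrite !inE => /orP[] /eqP ac; move: h; rewrite ac.
  by rewrite perm_cons => /perm_small_eq -/(_ isT) [->].
rewrite (permPr (_ : perm_eq _ [:: d; c])); last first.
  exact: permEl (perm_catC [:: _] [:: _]).
by rewrite perm_cons => /perm_small_eq -/(_ isT) [->]; exact: sym2C.
Qed.

Lemma mem_sym2 z a b : (z \in elts (sym2 a b)) = (z == a) || (z == b).
Proof. by rewrite (perm_mem (elts_sym2 a b)) !inE. Qed.

Lemma sym2_mem (p : Sym2) z : z \in elts p -> exists w, p = sym2 z w.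
Proof.
elim/sym2_ind: p => a b; rewrite mem_sym2 => /orP[] /eqP->; first by exists b.
by exists a; exact: sym2C.
Qed.

Lemma allpairs_sym2 (f : X -> Sym2) a b :
  perm_eq [seq t | u <- elts (sym2 a b), t <- elts (f u)]
          (elts (f a) ++ elts (f b)).
Proof.
apply: perm_trans (perm_flatten (perm_map _ (elts_sym2 a b))) _.
by [].
Qed.

Lemma sym2_injr a : injective (sym2 a).
Proof.
move=> b c /eqP; rewrite eq_sym2 => /orP[/eqP[->] //|].
by move=> /eqP[-> ->].
Qed.

End UnorderedPairs.

HB.instance Definition _ (X : topologicalType) :=
  Topological.copy (Sym2 X) (quotient_topology {eq_quot (swap_equiv X)}).

Lemma sym2_continuous (X : topologicalType) :
  continuous (fun p : X * X => sym2 p.1 p.2).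
Proof.
have -> : (fun p : X * X => sym2 p.1 p.2) = \pi_(Sym2 X).
  by apply/funext => -[].
exact: (@pi_continuous _ {eq_quot (swap_equiv X)}).
Qed.

(* Associativity compares x * (y * z) and (x * y) * z as four-element
   multisets, i.e. as sequences up to permutation. *)
HB.mixin Record isTwoValuedGroup X & Choice X := {
  tvmul : X -> X -> Sym2 X;
  tve : X;
  tvinv : X -> X;
  tvmulA : forall x y z,
    perm_eq [seq t | u <- elts (tvmul y z), t <- elts (tvmul x u)]
            [seq t | u <- elts (tvmul x y), t <- elts (tvmul u z)];
  tvmule : forall x, tvmul tve x = sym2 x x /\ tvmul x tve = sym2 x x;
  tvmulV : forall x,
    tve \in elts (tvmul x (tvinv x)) /\ tve \in elts (tvmul (tvinv x) x);
  tvinv_uniq : forall x y,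
    tve \in elts (tvmul x y) \/ tve \in elts (tvmul y x) -> y = tvinv x
}.

#[short(type="twoValuedGroupType")]
HB.structure Definition TwoValuedGroup :=
  {X of Choice X & isTwoValuedGroup X}.

HB.mixin Record isTopTwoValuedGroup X & Topological X & TwoValuedGroup X := {
  tvmul_continuous : continuous (fun p : X * X => tvmul p.1 p.2);
  tvinv_continuous : continuous (tvinv : X -> X)
}.

#[short(type="topTwoValuedGroupType")]
HB.structure Definition TopTwoValuedGroup :=
  {X of Topological X & TwoValuedGroup X & isTopTwoValuedGroup X}.

Declare Scope twoval_scope.
Delimit Scope twoval_scope with tv.
Notation "x ** y" := (tvmul x y) (at level 40, left associativity) : twoval_scope.
Local Open Scope twoval_scope.

Definition tv_commutative (X : twoValuedGroupType) : Prop :=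
  forall x y : X, x ** y = y ** x.

Definition tv_involutive (X : twoValuedGroupType) : Prop :=
  forall x : X, tvinv x = x.

Section Powers.
Variable X : twoValuedGroupType.
Implicit Types (x y z : X) (s : nat -> X).

Definition is_power_seq x s : Prop :=
  [/\ s 0%N = tve, s 1%N = x &
      forall k, (0 < k)%N -> x ** s k = sym2 (s k.-1) (s k.+1) /\
                             s k ** x = sym2 (s k.-1) (s k.+1)].

(* The power sequence x^0, x^1, ...; it exists and is unique in an involutive
   two-valued group ([tvpowP], [power_seq_uniq]). *)
Definition tvpow x : nat -> X := xget (fun=> tve) (is_power_seq x).

(* The order of x, [None] standing for infinity. *)
Definition tvord x : option nat :=
  match pselect (exists k, (0 < k)%N && (tvpow x k == tve)) with
  | left ex => Some (ex_minn ex)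
  | right _ => None
  end.

Lemma power_seq_uniq x s s' :
  is_power_seq x s -> is_power_seq x s' -> s = s'.
Proof.
move=> [s0 s1 sS] [s'0 s'1 s'S]; apply/funext => n.
suff: s n = s' n /\ s n.+1 = s' n.+1 by case.
elim: n => [|n [IH0 IH1]]; first by rewrite s0 s1 s'0 s'1.
split=> //; apply: (@sym2_injr _ (s n)).
have [<- _] := sS n.+1 isT; rewrite IH1 IH0.
by have [-> _] := s'S n.+1 isT.
Qed.

Hypothesis invX : tv_involutive X.

Lemma tve_mem_eq x y : tve \in elts (x ** y) -> y = x.
Proof. by move=> h; rewrite -[RHS]invX; apply: tvinv_uniq; left. Qed.

Lemma tvmul_rot x y z : z \in elts (x ** y) -> x \in elts (y ** z).
Proof.
move=> zxy.
have ezz : tve \in elts (z ** z) by have := (tvmulV z).1; rewrite invX.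
have : tve \in [seq t | u <- elts (x ** y), t <- elts (u ** z)].
  by apply/allpairsPdep; exists z, tve.
rewrite -(perm_mem (tvmulA x y z)) => /allpairsPdep[u [t [uyz txu et]]].
by move: txu; rewrite -et => /tve_mem_eq <-.
Qed.

Lemma tvpow_comm_step x a b c :
  x ** a = a ** x -> x ** b = b ** x -> x ** b = sym2 a c ->
  x ** c = c ** x.
Proof.
move=> ca cb bE; apply/eltsP.
have := tvmulA x b x; rewrite -cb bE.
rewrite (permPl (allpairs_sym2 (tvmul x) a c)).
rewrite (permPr (allpairs_sym2 (tvmul^~ x) a c)).
by rewrite ca perm_cat2l.
Qed.

Lemma power_seq_exists x : exists s, is_power_seq x s.
Proof.
have other (a b : X) : {c | a \in elts (x ** b) -> x ** b = sym2 a c}.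
  apply: cid; case: (boolP (a \in elts (x ** b))) => [/sym2_mem[c ->]|_].
    by exists c.
  by exists x.
pose st n := iter n (fun p => (p.2, sval (other p.1 p.2))) (tve, x).
pose s n := (st n).1.
have sS n : s n.+2 = sval (other (s n) (s n.+1)) by [].
have inv n : [/\ x ** s n = s n ** x, x ** s n.+1 = s n.+1 ** x &
                 s n \in elts (x ** s n.+1)].
  elim: n => [|n [c1 c2 m]].
    rewrite /s /= ; split=> //.
      by rewrite (tvmule x).1 (tvmule x).2.
    by have := (tvmulV x).1; rewrite invX.
  have e : x ** s n.+1 = sym2 (s n) (s n.+2).
    by rewrite sS; exact: svalP (other (s n) (s n.+1)) m.
  have c3 := tvpow_comm_step c1 c2 e.
  by split=> //; apply: tvmul_rot; rewrite -c2 e mem_sym2 eqxx orbT.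
exists s; split=> // -[//|k] _ /=.
have [_ <- m] := inv k.
by rewrite sS -(svalP (other (s k) (s k.+1)) m).
Qed.

Lemma tvpowP x : is_power_seq x (tvpow x).
Proof. exact: xgetPex (power_seq_exists x). Qed.

End Powers.

Record topInvolution (A : topologicalZmodType) := TopInvolution {
  invol :> {additive A -> A};
  invol_continuous : continuous invol;
  involK : involutive invol
}.

Section Coset.
Local Open Scope ring_scope.
Variables (A : topologicalZmodType) (i : topInvolution A).
Implicit Types a b c : A.

Definition orbit_rel : rel A := fun a b => (b == a) || (b == i a).

Lemma orbit_rel_refl : reflexive orbit_rel.
Proof. by move=> a; rewrite /orbit_rel eqxx. Qed.

Lemma orbit_rel_sym : symmetric orbit_rel.
Proof.
move=> a b; rewrite /orbit_rel (eq_sym b a); congr (_ || _).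
by apply/eqP/eqP => ->; rewrite involK.
Qed.

Lemma orbit_rel_trans : transitive orbit_rel.
Proof.
move=> a b c /orP[] /eqP-> /orP[] /eqP->; rewrite /orbit_rel ?involK ?eqxx ?orbT //.
Qed.

Canonical orbit_equiv :=
  EquivRel orbit_rel orbit_rel_refl orbit_rel_sym orbit_rel_trans.

Definition tvcoset : Type := quotient_topology {eq_quot orbit_equiv}.
HB.instance Definition _ := Topological.on tvcoset.
HB.instance Definition _ := Quotient.on tvcoset.

Definition coset_pi (a : A) : tvcoset := \pi_tvcoset a.

(* pi(a) * pi(b) = [pi(a + b), pi(a + i b)], see [coset_mulE]. *)
Definition coset_mul (p q : tvcoset) : Sym2 tvcoset :=
  sym2 (coset_pi (repr p + repr q)) (coset_pi (repr p + i (repr q))).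

Definition coset_inv (p : tvcoset) : tvcoset := coset_pi (- repr p).

Lemma eq_coset_pi a b : (coset_pi a == coset_pi b) = (b == a) || (b == i a).
Proof.
by apply/eqP/idP => [|h];
  [move/(@eqmodP _ orbit_equiv a b)|exact/(@eqmodP _ orbit_equiv a b)].
Qed.

Lemma coset_pi_invol a : coset_pi (i a) = coset_pi a.
Proof. by apply/eqP; rewrite eq_coset_pi involK eqxx orbT. Qed.

Lemma coset_ind (P : tvcoset -> Prop) : (forall a, P (coset_pi a)) -> forall p, P p.
Proof. by move=> h p; rewrite -[p]reprK. Qed.

Lemma repr_coset_pi a : repr (coset_pi a) = a \/ repr (coset_pi a) = i a.
Proof.
have : coset_pi a == coset_pi (repr (coset_pi a)) by rewrite /coset_pi reprK.
by rewrite eq_coset_pi => /orP[] /eqP ->; [left|right].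
Qed.

Lemma coset_mulE a b :
  coset_mul (coset_pi a) (coset_pi b) =
  sym2 (coset_pi (a + b)) (coset_pi (a + i b)).
Proof.
have e1 : coset_pi (i a + i b) = coset_pi (a + b).
  by rewrite -[RHS]coset_pi_invol raddfD.
have e2 : coset_pi (i a + b) = coset_pi (a + i b).
  by rewrite -[RHS]coset_pi_invol raddfD involK.
rewrite /coset_mul; case: (repr_coset_pi a) => ->; case: (repr_coset_pi b) => ->;
  rewrite ?involK ?e1 ?e2 //; exact: sym2C.
Qed.

Lemma coset_invE a : coset_inv (coset_pi a) = coset_pi (- a).
Proof.
rewrite /coset_inv; case: (repr_coset_pi a) => -> //.
by rewrite -[RHS]coset_pi_invol raddfN.
Qed.

Lemma coset_mulA (x y z : tvcoset) :
  perm_eq [seq t | u <- elts (coset_mul y z), t <- elts (coset_mul x u)]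
          [seq t | u <- elts (coset_mul x y), t <- elts (coset_mul u z)].
Proof.
elim/coset_ind: x => a; elim/coset_ind: y => b; elim/coset_ind: z => c.
rewrite !coset_mulE.
rewrite (permPl (allpairs_sym2 (coset_mul (coset_pi a)) _ _)).
rewrite (permPr (allpairs_sym2 (coset_mul^~ (coset_pi c)) _ _)).
rewrite !coset_mulE.
rewrite (permPl (perm_cat (elts_sym2 _ _) (elts_sym2 _ _))).
rewrite (permPr (perm_cat (elts_sym2 _ _) (elts_sym2 _ _))).
rewrite !raddfD involK !addrA /=.
set p := coset_pi _; set q := coset_pi _; set r := coset_pi _.
set s := coset_pi _.
by rewrite perm_cons; exact: permEl (perm_catC [:: q] [:: r; s]).
Qed.

Lemma coset_mule (x : tvcoset) :
  coset_mul (coset_pi 0) x = sym2 x x /\ coset_mul x (coset_pi 0) = sym2 x x.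
Proof.
by elim/coset_ind: x => a; rewrite !coset_mulE raddf0 !add0r addr0 coset_pi_invol.
Qed.

Lemma coset_mulV (x : tvcoset) :
  coset_pi 0 \in elts (coset_mul x (coset_inv x)) /\
  coset_pi 0 \in elts (coset_mul (coset_inv x) x).
Proof.
elim/coset_ind: x => a; rewrite coset_invE !coset_mulE !mem_sym2.
by rewrite subrr addNr !eqxx.
Qed.

Lemma coset_inv_uniq (x y : tvcoset) :
  coset_pi 0 \in elts (coset_mul x y) \/ coset_pi 0 \in elts (coset_mul y x) ->
  y = coset_inv x.
Proof.
elim/coset_ind: x => a; elim/coset_ind: y => b.
rewrite coset_invE !coset_mulE !mem_sym2 !eq_coset_pi raddf0 !orbb.
rewrite [b + a]addrC => -[] /orP[]; rewrite ?addr_eq0 => /eqP e.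
- by rewrite e opprK.
- by rewrite e opprK coset_pi_invol.
- by rewrite e opprK.
- by rewrite -[RHS]coset_pi_invol raddfN e.
Qed.

HB.instance Definition _ := isTwoValuedGroup.Build tvcoset
  coset_mulA coset_mule coset_mulV coset_inv_uniq.

Lemma coset_pi_continuous : continuous coset_pi.
Proof. exact: (@pi_continuous _ {eq_quot orbit_equiv}). Qed.

Lemma coset_pi_nbhs a (V : set A) : nbhs a V -> nbhs (coset_pi a) (coset_pi @` V).
Proof.
rewrite nbhsE => -[U [oU Ua] UV].
rewrite nbhsE; exists (coset_pi @` U); last exact: image_subset.
split; last by exists a.
rewrite /open /= /quotient_open.
have -> : \pi_(quotient_topology {eq_quot orbit_equiv}) @^-1` (coset_pi @` U) =
          U `|` i @^-1` U.
  apply/seteqP; split => [b [c Uc] /eqP|b [Ub|Ub]] /=.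
  - rewrite (eq_coset_pi c b) => /orP[] /eqP ->; first by left.
    by right; rewrite /= involK.
  - by exists b.
  - by exists (i b) => //; exact: coset_pi_invol.
apply: openU => //; apply: open_comp => // b _; exact: invol_continuous.
Qed.

Lemma coset_mul_continuous :
  continuous (fun p : tvcoset * tvcoset => (p.1 : tvcoset) ** p.2).
Proof.
move=> [p q]; elim/coset_ind: p => a; elim/coset_ind: q => b.
have h1 : continuous (fun u : A * A => coset_pi (u.1 + u.2)).
  move=> u; apply: (@continuous_comp _ _ _ (fun u : A * A => u.1 + u.2)).
    exact: add_continuous.
  exact: coset_pi_continuous.
have h2 : continuous (fun u : A * A => coset_pi (u.1 + i u.2)).
  move=> u; apply: (@continuous_comp _ _ _ (fun u : A * A => u.1 + i u.2)).
    apply: (@continuous_comp _ _ _ (fun u : A * A => (u.1, i u.2))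
      (fun u : A * A => u.1 + u.2)); last exact: add_continuous.
    apply: cvg_pair; first exact: cvg_fst.
    by apply: continuous_comp; [exact: cvg_snd|exact: invol_continuous].
  exact: coset_pi_continuous.
pose F (u : A * A) : tvcoset * tvcoset := (coset_pi (u.1 + u.2), coset_pi (u.1 + i u.2)).
have hF : continuous F by move=> u; exact: cvg_pair (h1 u) (h2 u).
pose G (p : tvcoset * tvcoset) : Sym2 tvcoset := sym2 p.1 p.2.
have hG : continuous G := @sym2_continuous tvcoset.
have h : continuous (fun u : A * A => coset_pi u.1 ** coset_pi u.2).
  move=> u.
  have -> : (fun u : A * A => coset_pi u.1 ** coset_pi u.2) = G \o F.
    by apply/funext => v; exact: coset_mulE.
  exact: cvg_comp (hF u) (hG (F u)).
move=> W /= Wab; have /= [[U V] /= [Ua Vb] UV] := h (a, b) W Wab.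
exists (coset_pi @` U, coset_pi @` V) => /=; first by split; exact: coset_pi_nbhs.
by move=> [_ _] /= [[c Uc <-] [d Vd <-]]; exact: (UV (c, d)).
Qed.

Lemma coset_inv_continuous : continuous (tvinv : tvcoset -> tvcoset).
Proof.
have h : continuous (coset_inv \o coset_pi).
  have -> : coset_inv \o coset_pi = coset_pi \o -%R.
    by apply/funext => a; exact: coset_invE.
  move=> a; apply: continuous_comp; first exact: opp_continuous.
  exact: coset_pi_continuous.
by have [_] := @quotient_continuous _ {eq_quot orbit_equiv} _ coset_inv; apply.
Qed.

HB.instance Definition _ := isTopTwoValuedGroup.Build tvcoset
  coset_mul_continuous coset_inv_continuous.

End Coset.

Definition antipodal (A : topologicalZmodType) : topInvolution A :=
  @TopInvolution A -%R%R (@opp_continuous A) (@opprK A).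

Definition homeomorphism (X Y : topologicalType) (f : X -> Y) : Prop :=
  exists2 g : Y -> X, cancel f g /\ cancel g f & continuous f /\ continuous g.

Definition tv_isomorphism (X Y : topTwoValuedGroupType) (f : X -> Y) : Prop :=
  homeomorphism f /\
  forall x y z1 z2 : X,
    x ** y = sym2 z1 z2 -> f x ** f y = sym2 (f z1) (f z2).

Definition tv_isomorphic (X Y : topTwoValuedGroupType) : Prop :=
  exists f : X -> Y, tv_isomorphism f.

(* Main.v *)
Require Import Defs.
From HB Require Import structures.
From mathcomp Require Import all_boot all_order all_algebra.
From mathcomp Require Import all_classical all_reals all_analysis.
From mathcomp Require Import zify.

(* Fix [x] with [x^4 <> e]; in the model [X = A / {1, -1}] it is the class of some [a] with
   [4a <> 0].  Then [b] in [A] is determined by the classes [y] of [b] and [z] of [a + b], so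
   [A] is recovered as the space of pairs [(y, z)] with [z \in x * y].

   The key fact is the parallelogram law: if [x * y = [z, w]], then [z * w = [x^2, y^2]] and
   [x^2 * y^2 = [z^2, w^2]].  Squaring [x * y = z + w] gives it up to one quaternion-like
   configuration, which is incompatible with the existence of an element with [x^4 <> e].
   With this law, the four elements of [x * y * t] are shown to label the vertices of a
   tetrahedron, opposite edges of which are cut out by [x * y], [y * t] and [x * t]; this
   provides, for [b = (y, z)] and [c = (t, s)], a pair [(p, q)] that behaves as [b + c].

   Group laws come from representing [b] by the commuting operators
   [b (a - a^-1) = z - y a^-1] on pairs of functions on [X]: the factor [a - a^-1]
   squares to multiplication by [x^2 - e], which is injective on differences of points of [X].
   For continuity, all the equations defining [(p, q)] pass to the limit along ultrafilters. *)

Set Implicit Arguments.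
Unset Strict Implicit.
Unset Printing Implicit Defensive.

Import GRing.Theory.
Local Open Scope twoval_scope.
Local Open Scope ring_scope.

Ltac sym2_tac := first [by [] | by rewrite sym2C | by rewrite [RHS]sym2C].
Ltac sym2_or := first [left; sym2_tac | right; sym2_tac].
Ltac labels_tac := first [left; split; sym2_tac | right; split; sym2_tac].

(** * Unordered pairs *)

Section Pairs.
Variable X : choiceType.
Implicit Types (a b c d x y z u p q m n : X) (f : X -> int) (A B C : Sym2 X).

(** Multiset identities are stated below as equalities of sums of [f] for all [f : X -> int], which
    [lia] can add and cancel; indicators recover multiplicities. *)
Definition ind1 a : X -> int := fun v => (v == a)%:Z.

Lemma ind1_id a : ind1 a a = 1.
Proof. by rewrite /ind1 eqxx. Qed.

Lemma ind1_neq a b : a != b -> ind1 b a = 0.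
Proof. by rewrite /ind1 => /negPf->. Qed.

Lemma sym2_eqP a b c d :
  sym2 a b = sym2 c d <-> (a = c /\ b = d) \/ (a = d /\ b = c).
Proof.
split=> [/eqP|[[-> ->]|[-> ->]]] //; last exact: sym2C.
by rewrite eq_sym2 => /orP[] /eqP[-> ->]; [left|right].
Qed.

Lemma sym2_sum a b c d f : sym2 a b = sym2 c d -> f a + f b = f c + f d.
Proof. by move=> /sym2_eqP[[-> ->]|[-> ->]] //; exact: addrC. Qed.

Lemma eq_of_fun a b : (forall f, f a = f b) -> a = b.
Proof. by move=> /(_ (ind1 b)); rewrite ind1_id /ind1; case: eqP. Qed.

Lemma sum_sym2 a b c d :
  (forall f, f a + f b = f c + f d) -> sym2 a b = sym2 c d.
Proof.
move=> h; have [ca|nca] := eqVneq c a.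
  by congr sym2 => //; apply: eq_of_fun => f; have := h f; rewrite ca; lia.
have [da|nda] := eqVneq d a.
  rewrite sym2C; congr sym2 => //; apply: eq_of_fun => f.
  by have := h f; rewrite da; lia.
have := h (ind1 a); rewrite ind1_id (ind1_neq nca) (ind1_neq nda) /ind1.
by case: (b == a).
Qed.

Lemma quad_mem a b c d u1 u2 u3 u4 :
  (forall f, f a + f b + f c + f d = f u1 + f u2 + f u3 + f u4) ->
  [\/ u1 = a, u1 = b, u1 = c | u1 = d].
Proof.
move=> /(_ (ind1 u1)); rewrite /ind1 eqxx.
have [->|na] := eqVneq a u1; first by constructor 1.
have [->|nb] := eqVneq b u1; first by constructor 2.
have [->|nc] := eqVneq c u1; first by constructor 3.
have [->|nd] := eqVneq d u1; first by constructor 4.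
by case: (u2 == u1); case: (u3 == u1); case: (u4 == u1).
Qed.

Lemma tri_mem a b c u1 u2 u3 :
  (forall f, f a + f b + f c = f u1 + f u2 + f u3) ->
  [\/ u1 = a, u1 = b | u1 = c].
Proof.
move=> /(_ (ind1 u1)); rewrite /ind1 eqxx.
have [->|na] := eqVneq a u1; first by constructor 1.
have [->|nb] := eqVneq b u1; first by constructor 2.
have [->|nc] := eqVneq c u1; first by constructor 3.
by case: (u2 == u1); case: (u3 == u1).
Qed.

Lemma tri_split a b c u1 u2 u3 :
  (forall f, f a + f b + f c = f u1 + f u2 + f u3) ->
  [\/ u1 = a /\ sym2 u2 u3 = sym2 b c,
      u1 = b /\ sym2 u2 u3 = sym2 a c
    | u1 = c /\ sym2 u2 u3 = sym2 a b].
Proof.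
move=> h; have [e|e|e] := tri_mem h; rewrite {u1}e in h *;
  [constructor 1|constructor 2|constructor 3]; split=> //;
  by apply: sum_sym2 => f; have := h f; lia.
Qed.

Lemma quad_split a b c d a' b' c' d' :
  (forall f, f a + f b + f c + f d = f a' + f b' + f c' + f d') ->
  [\/ sym2 a' b' = sym2 a b /\ sym2 c' d' = sym2 c d,
      sym2 a' b' = sym2 c d /\ sym2 c' d' = sym2 a b
    | [\/ sym2 a' b' = sym2 a c /\ sym2 c' d' = sym2 b d,
          sym2 a' b' = sym2 b d /\ sym2 c' d' = sym2 a c,
          sym2 a' b' = sym2 a d /\ sym2 c' d' = sym2 b c
        | sym2 a' b' = sym2 b c /\ sym2 c' d' = sym2 a d]].
Proof.
move=> h; have [e|e|e|e] := quad_mem h; rewrite {a'}e in h *.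
- have /tri_split[[-> ->]|[-> ->]|[-> ->]] :
    forall f, f b + f c + f d = f b' + f c' + f d' by move=> f; have := h f; lia.
  + by constructor 1.
  + by constructor 3; constructor 1.
  + by constructor 3; constructor 3.
- have /tri_split[[-> ->]|[-> ->]|[-> ->]] :
    forall f, f a + f c + f d = f b' + f c' + f d' by move=> f; have := h f; lia.
  + by constructor 1; rewrite sym2C.
  + by constructor 3; constructor 4.
  + by constructor 3; constructor 2.
- have /tri_split[[-> ->]|[-> ->]|[-> ->]] :
    forall f, f a + f b + f d = f b' + f c' + f d' by move=> f; have := h f; lia.
  + by constructor 3; constructor 1; rewrite sym2C.
  + by constructor 3; constructor 4; rewrite sym2C.
  + by constructor 2.
- have /tri_split[[-> ->]|[-> ->]|[-> ->]] :
    forall f, f a + f b + f c = f b' + f c' + f d' by move=> f; have := h f; lia.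
  + by constructor 3; constructor 3; rewrite sym2C.
  + by constructor 3; constructor 2; rewrite sym2C.
  + by constructor 2; rewrite (sym2C d c).
Qed.

Definition sym2_meet A B := exists2 a, a \in elts A & a \in elts B.

Lemma sym2_meetE a b c d : sym2_meet (sym2 a b) (sym2 c d) ->
  (a = c \/ b = d) \/ (a = d \/ b = c).
Proof.
by case=> k; rewrite !mem_sym2 => /orP[] /eqP-> /orP[] /eqP->; tauto.
Qed.

(** The [q]s form a 2-by-2 table with rows [a, b] and [c, d] and columns [a', b'] and [c', d']. If
    both splittings use the same pairs, a value common to the two rows fills two opposite
    corners. *)
Lemma grid a b c d a' b' c' d' :
  (forall f, f a + f b + f c + f d = f a' + f b' + f c' + f d') ->
  sym2_meet (sym2 a b) (sym2 a' b') -> sym2_meet (sym2 c d) (sym2 a' b') ->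
  exists q0 q1 q2 q3, [/\ sym2 a b = sym2 q0 q1, sym2 c d = sym2 q2 q3,
    sym2 a' b' = sym2 q0 q2 & sym2 c' d' = sym2 q1 q3].
Proof.
move=> h m1 m2.
have [[e1 e2]|[e1 e2]|[[e1 e2]|[e1 e2]|[e1 e2]|[e1 e2]]] := quad_split h;
  rewrite e1 e2 in m1 m2 *.
- have [[?|?]|[?|?]] := sym2_meetE m2; subst.
  + by exists b, a, a, d; split; sym2_tac.
  + by exists a, b, b, c; split; sym2_tac.
  + by exists a, b, b, d; split; sym2_tac.
  + by exists b, a, a, c; split; sym2_tac.
- have [[?|?]|[?|?]] := sym2_meetE m1; subst.
  + by exists c, b, d, c; split; sym2_tac.
  + by exists d, a, c, d; split; sym2_tac.
  + by exists d, b, c, d; split; sym2_tac.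
  + by exists c, a, d, c; split; sym2_tac.
- by exists a, b, c, d.
- by exists b, a, d, c; split; sym2_tac.
- by exists a, b, d, c; split; sym2_tac.
- by exists b, a, c, d; split; sym2_tac.
Qed.

(* Three splittings of a four-element multiset into pairs are the three perfect matchings of
   labels [q0 .. q3].  Pairwise intersections leave one obstruction, three equal splittings
   [a, b], [a, d] of [a, a, b, d], which the last hypothesis rules out. *)
Lemma tetra_labels a b c d a' b' c' d' g k g' k' :
  (forall f, f a + f b + f c + f d = f a' + f b' + f c' + f d') ->
  (forall f, f a + f b + f c + f d = f g + f k + f g' + f k') ->
  sym2_meet (sym2 a b) (sym2 a' b') -> sym2_meet (sym2 c d) (sym2 a' b') ->
  sym2_meet (sym2 a b) (sym2 g k) -> sym2_meet (sym2 c d) (sym2 g k) ->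
  sym2_meet (sym2 a' b') (sym2 g k) -> sym2_meet (sym2 c' d') (sym2 g k) ->
  (sym2 a b = sym2 a' b' \/ sym2 a b = sym2 c' d' ->
   sym2 a b = sym2 g k \/ sym2 a b = sym2 g' k' -> a = b \/ c = d) ->
  exists q0 q1 q2 q3, [/\ sym2 a b = sym2 q0 q1, sym2 c d = sym2 q2 q3,
    sym2 a' b' = sym2 q0 q2, sym2 c' d' = sym2 q1 q3 &
    (sym2 g k = sym2 q0 q3 /\ sym2 g' k' = sym2 q1 q2) \/
    (sym2 g k = sym2 q1 q2 /\ sym2 g' k' = sym2 q0 q3)].
Proof.
move=> hB hC mAB mA'B mAC mA'C mBC mB'C bad.
have [q0 [q1 [q2 [q3 [eA eA' eB eB']]]]] := grid hB mAB mA'B.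
exists q0, q1, q2, q3; split=> //.
have {}bad : (sym2 q0 q1 = sym2 q0 q2 \/ sym2 q0 q1 = sym2 q1 q3) ->
   (sym2 q0 q1 = sym2 g k \/ sym2 q0 q1 = sym2 g' k') -> q0 = q1 \/ q2 = q3.
  rewrite -eB -eB' -eA => h1 h2; have [ab|cd] := bad h1 h2.
    by left; move: eA; rewrite ab => /esym/sym2_eqP[[-> ->]|[-> ->]].
  by right; move: eA'; rewrite cd => /esym/sym2_eqP[[-> ->]|[-> ->]].
have {}hC : forall f, f q0 + f q1 + f q2 + f q3 = f g + f k + f g' + f k'.
  by move=> f; rewrite -hC; have := sym2_sum f eA; have := sym2_sum f eA'; lia.
rewrite eA eA' eB eB' in mAC mA'C mBC mB'C.
have [[e1 e2]|[e1 e2]|[[e1 e2]|[e1 e2]|[e1 e2]|[e1 e2]]] := quad_split hC;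
  rewrite e1 e2 in mAC mA'C mBC mB'C bad *.
- have [[?|?]|[?|?]] := sym2_meetE mA'C; subst; try labels_tac;
    by have [||?|?] := bad; try sym2_or; subst; labels_tac.
- have [[?|?]|[?|?]] := sym2_meetE mAC; subst; try labels_tac;
    by have [||?|?] := bad; try sym2_or; subst; labels_tac.
- have [[?|?]|[?|?]] := sym2_meetE mB'C; subst; try labels_tac;
    by have [||?|?] := bad; try sym2_or; subst; labels_tac.
- have [[?|?]|[?|?]] := sym2_meetE mBC; subst; try labels_tac;
    by have [||?|?] := bad; try sym2_or; subst; labels_tac.
- by left.
- by right.
Qed.

Lemma split_diag a b c d g k g' k' :
  (forall f, f a + f b + f c + f d = f g + f k + f g' + f k') ->
  sym2 a b = sym2 g k \/ sym2 a b = sym2 g' k' -> g = k \/ g' = k' -> a = b \/ c = d.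
Proof.
move=> H ab.
have cd : sym2 c d = sym2 g' k' /\ sym2 a b = sym2 g k \/
          sym2 c d = sym2 g k /\ sym2 a b = sym2 g' k'.
  by case: ab => E; [left|right]; split=> //; apply: sum_sym2 => f;
    have := H f; have := sym2_sum f E; lia.
by case: cd => -[/sym2_eqP[[-> ->]|[-> ->]] /sym2_eqP[[-> ->]|[-> ->]]]; intuition.
Qed.

(** If [p <> p'] sit at [n1] and [n0] instead, the other two equations force [m = p'] and [m1 = p],
    so both diagonals keep the required form. *)
Lemma fold_labels p p' m m1 n0 n1 n2 n3 S :
  sym2 p p' = sym2 n0 n1 -> sym2 p m = sym2 n0 n2 -> sym2 p' m1 = sym2 n1 n3 ->
  S = sym2 n0 n3 \/ S = sym2 n1 n2 -> S = sym2 m p' \/ S = sym2 p m1.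
Proof.
move=> /sym2_eqP[[<- <-]|[<- <-]].
  by move=> /sym2_injr <- /sym2_injr <- [->|->]; [right|left; rewrite sym2C].
have [<-|pp'] := eqVneq p p'.
  by move=> /sym2_injr <- /sym2_injr <- [->|->]; [right|left; rewrite sym2C].
move=> /sym2_eqP[[pp]|[? ?]]; first by rewrite pp eqxx in pp'.
move=> /sym2_eqP[[pp]|[? ?]]; first by rewrite pp eqxx in pp'.
by subst; case; [left|right].
Qed.

End Pairs.

(** * The parallelogram law and the addition of pairs *)

Section Algebra.
Variable X : twoValuedGroupType.
Hypotheses (involX : tv_involutive X) (commX : tv_commutative X).
Implicit Types (a b c d x y z t h p q : X) (f : X -> int).
Local Notation e := (@tve X).

Lemma sym2_exists (p : Sym2 X) : exists a b, p = sym2 a b.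
Proof. by elim/sym2_ind: p => a b; exists a, b. Qed.

Lemma tvmulee x : e ** x = sym2 x x.
Proof. exact: (tvmule x).1. Qed.

Lemma quad_assoc x y t z w p p' a b c d a' b' c' d' :
  x ** y = sym2 z w -> y ** t = sym2 p p' ->
  z ** t = sym2 a b -> w ** t = sym2 c d ->
  x ** p = sym2 a' b' -> x ** p' = sym2 c' d' ->
  forall f, f a + f b + f c + f d = f a' + f b' + f c' + f d'.
Proof.
move=> xy yt zt wt xp xp' f.
have := tvmulA x y t; rewrite xy yt.
rewrite (permPl (allpairs_sym2 (tvmul x) p p')).
rewrite (permPr (allpairs_sym2 (tvmul^~ t) z w)) zt wt xp xp'.
rewrite (permPl (perm_cat (elts_sym2 _ _) (elts_sym2 _ _))).
rewrite (permPr (perm_cat (elts_sym2 _ _) (elts_sym2 _ _))) => /(perm_big _).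
move=> /(_ int +%R 0 xpredT f) /=.
by rewrite !big_cons !big_nil !addr0 !addrA => ->.
Qed.

Lemma tv_rot x y z w : x ** y = sym2 z w -> exists v, x ** z = sym2 y v.
Proof.
move=> xy; apply: sym2_mem; apply: tvmul_rot => //.
by rewrite commX xy mem_sym2 eqxx.
Qed.

Lemma tve_eq x y w : x ** y = sym2 e w -> x = y.
Proof.
by move=> xy; apply/esym; apply: (tve_mem_eq involX); rewrite xy mem_sym2 eqxx.
Qed.

Definition sq x : X := sval (cid (sym2_mem (let: conj m _ := tvmulV x in m))).

Lemma tv_sq x : x ** x = sym2 e (sq x).
Proof. by rewrite /sq; case: cid => w /= <-; rewrite involX. Qed.

Lemma sq_uniq x w : x ** x = sym2 e w -> w = sq x.
Proof. by rewrite tv_sq => /sym2_injr->. Qed.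

Lemma sq_e : sq e = e.
Proof. by apply/esym/sq_uniq; rewrite tvmulee. Qed.

(** * Convolution operators on functions *)

Definition tvconv y f : X -> int := fun u => \sum_(v <- elts (y ** u)) f v.

Lemma tvconvE y u a b f : y ** u = sym2 a b -> tvconv y f u = f a + f b.
Proof.
by move=> yu; rewrite /tvconv yu (perm_big _ (elts_sym2 a b)) !big_cons big_nil /= addr0.
Qed.

Lemma tvconv_e y f : tvconv y f e = f y + f y.
Proof. by apply: tvconvE; rewrite (tvmule y).2. Qed.

(** This is associativity; two-valued products can now be computed as products of commuting
    operators, with [e] acting as multiplication by 2. *)
Lemma tvconvM y t p p' f u :
  y ** t = sym2 p p' -> tvconv y (tvconv t f) u = tvconv p f u + tvconv p' f u.
Proof.
move=> yt; have [a [b yu]] := sym2_exists (y ** u).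
have [a1 [a2 ta]] := sym2_exists (t ** a); have [b1 [b2 tb]] := sym2_exists (t ** b).
have [c1 [c2 pu]] := sym2_exists (p ** u); have [d1 [d2 qu]] := sym2_exists (p' ** u).
rewrite (tvconvE _ yu) (tvconvE _ ta) (tvconvE _ tb) (tvconvE _ pu) (tvconvE _ qu).
rewrite commX in yt.
by have := quad_assoc yt yu pu qu ta tb f; rewrite !addrA => ->.
Qed.

Lemma tvconvC y t f u : tvconv y (tvconv t f) u = tvconv t (tvconv y f) u.
Proof.
have [p [p' yt]] := sym2_exists (y ** t).
by rewrite (tvconvM _ _ yt); rewrite commX in yt; rewrite (tvconvM _ _ yt).
Qed.

(** The product of the operators of [x], [y], [x], [y] is evaluated at [e] in two ways: as the
    square of [z + w], and as [(e + x^2)(e + y^2)]. *)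
Lemma sq_identity x y z w u v g k :
  x ** y = sym2 z w -> z ** w = sym2 u v -> sq x ** sq y = sym2 g k ->
  forall f, f (sq z) + f (sq w) + (f u + f v) *+ 2 =
            (f (sq x) + f (sq y)) *+ 2 + f g + f k.
Proof.
move=> xy zw gk f; have wz := zw; rewrite commX in wz.
have e1 : tvconv x (tvconv y (tvconv x (tvconv y f))) e =
    (f e + f (sq z) + (f u + f v) *+ 2 + f e + f (sq w)) *+ 2.
  rewrite (tvconvM _ _ xy) !tvconv_e !(tvconvM _ _ xy).
  rewrite (tvconvE _ (tv_sq z)) (tvconvE _ (tv_sq w)) (tvconvE _ zw) (tvconvE _ wz).
  by lia.
have e2 : tvconv x (tvconv y (tvconv x (tvconv y f))) e =
    (f e *+ 2 + f (sq y) *+ 2 + f (sq x) *+ 2 + f g + f k) *+ 2.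
  have -> : tvconv y (tvconv x (tvconv y f)) = tvconv x (tvconv y (tvconv y f)).
    by apply/funext => s; exact: tvconvC.
  rewrite (tvconvM _ _ (tv_sq x)) (tvconv_e e) (tvconv_e (sq x)) !(tvconvM _ _ (tv_sq y)) !tvconv_e.
  rewrite (tvconvE _ (tvmulee (sq x))).
  rewrite commX in gk; rewrite (tvconvE _ gk).
  by lia.
by move: e1 e2 => -> ; lia.
Qed.

(** * Elements of square [e] and their translations *)

Lemma sym2_same a b c : sym2 a b = sym2 c c -> a = c /\ b = c.
Proof. by move=> /sym2_eqP[|] []. Qed.

(** In the model [2h = 0], so [h + y = h - (-y)] and [h - y] have the same class. If [z <> w], then
    [e] is not in [z ** w], and counting [e] in [sq_identity] forces [z^2 = e] and [y^2 <> e];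
    associativity gives [h ** z = [y, y]], for which the same count fails. *)
Lemma double_square h y z w : sq h = e -> h ** y = sym2 z w -> z = w.
Proof.
move=> h2 hy; apply: contrapT => /eqP zw.
have [u [v zw']] := sym2_exists (z ** w).
have ue : u != e.
  by apply: contra zw => /eqP ue; apply/eqP/(@tve_eq _ _ v); rewrite zw' ue.
have ve : v != e.
  by apply: contra zw => /eqP ve; apply/eqP/(@tve_eq _ _ u); rewrite zw' ve sym2C.
have := sq_identity hy zw' (_ : _ = sym2 (sq y) (sq y)).
rewrite h2 tvmulee => /(_ erefl) /(_ (ind1 e)).
rewrite !(ind1_neq ue, ind1_neq ve) ind1_id => H.
have [z2 y2] : sq z = e /\ sq y != e.
  by move: H; rewrite /ind1; case: (sq z =P e); case: (sq w =P e); case: (sq y =P e).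
have [a [b hz]] := sym2_exists (h ** z); have [c [d hw]] := sym2_exists (h ** w).
have hh := tv_sq h; rewrite h2 in hh.
have Q := quad_assoc hh hy (tvmulee y) (tvmulee y) hz hw.
have [ay by_] : a = y /\ b = y.
  by have [||[]] := quad_split Q => -[] /sym2_same.
rewrite ay by_ in hz.
have := sq_identity hz (tv_sq y) (_ : _ = sym2 (sq z) (sq z)).
rewrite h2 tvmulee z2 => /(_ erefl) /(_ (ind1 e)).
by rewrite (ind1_neq y2) ind1_id.
Qed.

(* Translation by an element [h] with [h * h = [e, e]]; for other [h] it is a junk value. *)
Definition tvtr h y : X := (repr (h ** y)).1.

Lemma tvtrE h y : sq h = e -> h ** y = sym2 (tvtr h y) (tvtr h y).
Proof.
move=> h2; have hy := sym2_repr (h ** y).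
by rewrite [LHS]hy /tvtr -(double_square h2 hy).
Qed.

Lemma tvtr_uniq h y z w : sq h = e -> h ** y = sym2 z w -> z = tvtr h y.
Proof. by move=> h2; rewrite tvtrE // => /esym/sym2_same[]. Qed.

Lemma tvtr_e h : sq h = e -> tvtr h e = h.
Proof. by move=> h2; apply/esym/(@tvtr_uniq _ _ _ h) => //; rewrite (tvmule h).2. Qed.

Lemma tvtrM h y t p p' : sq h = e -> y ** t = sym2 p p' ->
  tvtr h y ** t = sym2 (tvtr h p) (tvtr h p').
Proof.
move=> h2 yt; have [a [b ab]] := sym2_exists (tvtr h y ** t).
rewrite ab; apply: sum_sym2 => f.
have := quad_assoc (tvtrE y h2) yt ab ab (tvtrE p h2) (tvtrE p' h2) f.
by lia.
Qed.

Lemma sq_tvtr h y : sq h = e -> sq (tvtr h y) = sq y.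
Proof.
move=> h2; apply: eq_of_fun => f.
have := sq_identity (tvtrE y h2) (tv_sq _) (_ : _ = sym2 (sq y) (sq y)).
by rewrite h2 tvmulee => /(_ erefl f); lia.
Qed.

Lemma tvtr_mem h x y w : sq h = e -> x ** y = sym2 h w -> y = tvtr h x.
Proof.
move=> h2 xy; have [v] := tv_rot xy; rewrite commX.
exact: tvtr_uniq.
Qed.

(** * The parallelogram law *)

Lemma sq_mem x : exists w, x ** sq x = sym2 x w.
Proof. by have := tv_sq x; rewrite sym2C => /tv_rot. Qed.

(** [sq_identity] is applied to [x ** z = [y, y1]]. If [x^4 <> e], parity at [e] gives [y1^2 = e];
    then [y] is a translate of [x^2], so [x^2 ** y^2] contains [x^2], against [g <> x^2]. If
    [x^4 = e], comparison at [y^2] gives [y^2 = x^2]. *)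
Lemma para_core x y z w g : x ** y = sym2 z w -> sq z = sq x -> sq w = sq x ->
  sq x ** sq y = sym2 g g -> z ** w = sym2 (sq y) g -> g <> sq x ->
  [/\ w = z, sq y = sq x, sq z = sq x, sq (sq x) = e & sq x <> e].
Proof.
move=> xy zx wx xxyy zw gx.
have y2 : sq y <> e.
  by move=> y2; move: xxyy; rewrite y2 (tvmule _).2 => /sym2_same[_ /esym].
have x2 : sq x <> e.
  move=> x2; have zE := tvtr_uniq x2 xy.
  by apply: y2; rewrite -(sq_tvtr y x2) -zE zx.
have [y1 xz] := tv_rot xy.
have [u [v yy1]] := sym2_exists (y ** y1).
have := sq_identity xz yy1 (_ : _ = sym2 e (sq (sq x))).
rewrite zx tv_sq => /(_ erefl) H.
have [x4|x4] := eqVneq (sq (sq x)) e; last first.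
  exfalso; apply: gx.
  have y12 : sq y1 = e.
    have := H (ind1 e); rewrite ind1_id (ind1_neq x4) !(ind1_neq (introN eqP y2)).
    rewrite (ind1_neq (introN eqP x2)) /ind1.
    by case: (sq y1 =P e) => //; case: (u == e); case: (v == e).
  have zE : z = tvtr y1 x by apply: (tvtr_mem (w := y)) => //; rewrite sym2C.
  have yE : y = tvtr y1 (sq x).
    move: xz; rewrite zE commX (tvtrM y12 (tv_sq x)) (tvtr_e y12) [RHS]sym2C.
    by move/sym2_injr.
  move: xxyy; rewrite yE sq_tvtr //.
  by have [v' ->] := sq_mem (sq x) => /sym2_same[].
have yx : sq y = sq x.
  have := H (ind1 (sq y)); rewrite x4 ind1_id /ind1.
  rewrite (eq_sym e) (negPf (introN eqP y2)) (eq_sym (sq x)).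
  by case: (sq y =P sq x) => //; lia.
split=> //.
have ge : g = e by move: xxyy; rewrite yx tv_sq x4 => /sym2_same[].
by apply/esym; apply: (@tve_eq _ _ (sq y)); rewrite zw ge sym2C.
Qed.

(** Modulo 2, [sq_identity] reads [z^2 + w^2 = g + k]. If [z^2 <> w^2], this determines [[g, k]].
    Otherwise [g = k], and halving leaves three-element multisets, so [z^2] is [x^2], [y^2] or [g];
    only the first two can lead to the exception. *)
Lemma para_or x y z w : x ** y = sym2 z w ->
  (z ** w = sym2 (sq x) (sq y) /\ sq x ** sq y = sym2 (sq z) (sq w)) \/
  [/\ w = z, sq y = sq x, sq z = sq x, sq (sq x) = e & sq x <> e].
Proof.
move=> xy; have [u [v zw]] := sym2_exists (z ** w).
have [g [k gk]] := sym2_exists (sq x ** sq y).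
have H := sq_identity xy zw gk; rewrite zw gk.
have [zw2|zw2] := eqVneq (sq z) (sq w); last first.
  have gkE : sym2 g k = sym2 (sq z) (sq w).
    have h1 := H (ind1 (sq z)); have h2 := H (ind1 (sq w)).
    have [gz|gz] := eqVneq g (sq z).
      rewrite gz; congr sym2.
      move: h2; rewrite gz ind1_id (ind1_neq zw2) /ind1.
      by case: (k =P sq w) => //; lia.
    have kz : k = sq z.
      move: h1; rewrite eq_sym in zw2; rewrite ind1_id (ind1_neq zw2) (ind1_neq gz).
      by rewrite /ind1; case: (k =P sq z) => //; lia.
    rewrite kz sym2C; congr sym2.
    move: h2; rewrite kz ind1_id (ind1_neq zw2) /ind1.
    by case: (g =P sq w) => //; lia.
  left; split=> //; apply: sum_sym2 => f.
  by have := H f; have := sym2_sum f gkE; lia.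
have gkE : k = g.
  have := H (ind1 g); rewrite zw2 ind1_id /ind1.
  by case: (k =P g) => //; lia.
rewrite {k}gkE in gk H *.
have H' : forall f, f (sq x) + f (sq y) + f g = f (sq z) + f u + f v.
  by move=> f; have := H f; rewrite zw2; lia.
have [[zx uv]|[zy uv]|[zg uv]] := tri_split H'.
- have [gx|/eqP gx] := eqVneq g (sq x).
    by left; split; rewrite ?uv ?gx -?zw2 ?zx //; apply: sym2C.
  by right; apply: (para_core xy _ _ gk) => //; rewrite -?zw2 // zw uv.
- have [gy|/eqP gy] := eqVneq g (sq y).
    by left; split; rewrite ?uv ?gy -?zw2 ?zy.
  right; rewrite commX in xy; rewrite commX in gk.
  have [|||wz xy2 _ y4 y2] := para_core xy _ _ gk _ gy; rewrite -?zw2 ?zw ?uv //.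
  by split; rewrite ?xy2.
- by left; split; rewrite ?uv -?zw2 ?zg.
Qed.

Variable x0 : X.
Hypothesis x04 : sq (sq x0) <> e.

(** Here [y], [t], [p] behave like the quaternions [i], [j], [k], with [s] as [-1]. For [v = x0^2]
    one finds that [s] fixes [v] and [v^2 = s]; then every element of square [s] is a translate of
    [v] by an element of square [e]. Applied to [y] and [t], this gives [p^2 = e]. *)
Lemma no_quaternion y t p : y ** t = sym2 p p -> sq y <> e -> sq (sq y) = e ->
  sq t = sq y -> sq p = sq y -> False.
Proof.
set s := sq y => yt s1 s2 ts ps.
pose v := sq x0.
have para x y' z w : sq (sq x) <> e -> x ** y' = sym2 z w ->
    z ** w = sym2 (sq x) (sq y') /\ sq x ** sq y' = sym2 (sq z) (sq w).
  by move=> x4 /para_or[//|[? ? ? /x4]].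
have [z [w xy]] := sym2_exists (x0 ** y).
have [q [r xp]] := sym2_exists (x0 ** p).
have sqz y' z' w' : sq y' = s -> x0 ** y' = sym2 z' w' -> sq z' = tvtr s v.
  by move=> ys /para[//|_]; rewrite ys commX; apply: (tvtr_uniq s2).
have z2 : sq z = tvtr s v by exact: (sqz y z w erefl xy).
have z4 : sq (sq z) <> e by rewrite z2 sq_tvtr.
have [a [b zt]] := sym2_exists (z ** t); have [c [d wt]] := sym2_exists (w ** t).
have Q := quad_assoc xy yt zt wt xp xp.
have [ab _] := para _ _ _ _ z4 zt; rewrite ts z2 in ab.
have [qr _] := para _ _ _ _ x04 xp; rewrite ps -/v in qr.
have tsv : tvtr s v <> e by move=> tse; apply: z4; rewrite z2 tse sq_e.
(* A diagonal pair would put [e] into [a ** b], whose values are [tvtr s v] and [s]. *)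
have notsame k : sym2 a b <> sym2 k k.
  move=> /sym2_same[ak bk]; move: ab; rewrite ak bk tv_sq.
  by move=> /sym2_eqP[[/esym]|[/esym]].
have {}tsv : tvtr s v = v.
  have abqr : sym2 a b = sym2 q r.
    have Q' : forall f, f q + f r + f q + f r = f a + f b + f c + f d.
      by move=> f; rewrite Q.
    have [||[]] := quad_split Q' => -[] // E _; first by case: (notsame _ E).
    - by case: (notsame _ E).
    - by rewrite E sym2C.
  have : a ** b = q ** r by move/sym2_eqP: abqr => [[-> ->]|[-> ->]].
  by rewrite ab qr sym2C (sym2C v) => /sym2_injr.
have v2 : sq v = s.
  have : v ** s = sym2 v v by rewrite commX tvtrE // tsv.
  by move=> /tv_rot[k]; rewrite tv_sq => /sym2_eqP[[/esym]|[_ ->]].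
have trv y' : sq y' = s -> exists2 k, sq k = e & y' = tvtr k v.
  move=> ys; have [z' [w' xy']] := sym2_exists (x0 ** y').
  have zz := sqz _ _ _ ys xy'; have [y1 xz] := tv_rot xy'.
  have [_] := para _ _ _ _ x04 xz; rewrite zz tsv tv_sq v2 ys sym2C => /sym2_injr.
  move=> /esym y12; exists y1 => //.
  have zE : z' = tvtr y1 x0 by apply: (tvtr_mem (w := y')) => //; rewrite sym2C.
  move: xz; rewrite zE commX (tvtrM y12 (tv_sq x0)) (tvtr_e y12) [RHS]sym2C.
  by move/sym2_injr.
have [k k2 yE] := trv y erefl; have [l l2 tE] := trv t ts.
have vt : v ** t = sym2 l (tvtr l s).
  by rewrite tE commX (tvtrM l2 (tv_sq v)) v2 tvtr_e.
move: yt; rewrite yE (tvtrM k2 vt) => /sym2_same[/esym pE _].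
by apply: s1; rewrite -ps pE sq_tvtr.
Qed.

Lemma parallelogram x y z w : x ** y = sym2 z w ->
  z ** w = sym2 (sq x) (sq y) /\ sq x ** sq y = sym2 (sq z) (sq w).
Proof.
move=> xy; have [//|[wz yx zx x4 x2]] := para_or xy.
by rewrite wz in xy; case: (no_quaternion xy).
Qed.

(* [x' \in t * s], hence [z \in x' * y] lies in [t * (s * y)]. *)
Lemma tv_meet x' y t z w s s' :
  x' ** y = sym2 z w -> x' ** t = sym2 s s' -> sym2_meet (z ** t) (y ** s).
Proof.
move=> xy; rewrite commX => /tv_rot[k ts].
have [u [v sy]] := sym2_exists (s ** y).
have [a [b tu]] := sym2_exists (t ** u); have [c [d tv]] := sym2_exists (t ** v).
have [a' [b' ky]] := sym2_exists (k ** y).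
have Q := quad_assoc ts sy xy ky tu tv.
have Q' : forall f, f a + f b + f c + f d = f z + f w + f a' + f b'.
  by move=> f; rewrite Q.
have zu : (z = a \/ z = b) \/ (z = c \/ z = d) by case: (quad_mem Q'); tauto.
rewrite (commX z) (commX y) sy.
case: zu => [zu|zu]; [exists u|exists v]; rewrite ?mem_sym2 ?eqxx ?orbT //;
  apply: (tvmul_rot involX); rewrite ?tu ?tv commX ?tu ?tv mem_sym2;
  by case: zu => ->; rewrite eqxx ?orbT.
Qed.

(** * Tetrahedra of triple products *)

Lemma tvmul_sym2 a b c d : sym2 a b = sym2 c d -> a ** b = c ** d.
Proof. by move=> /sym2_eqP[[-> ->]|[-> ->]]; rewrite // commX. Qed.

Lemma sq_eq_mem y t p p' : y ** t = sym2 p p' -> sq y = sq t -> sq p = e \/ sq p' = e.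
Proof.
move=> yt yt2; have [_] := parallelogram yt; rewrite yt2 tv_sq.
by move=> /sym2_eqP[[<-]|[<-]]; [left|right].
Qed.

(** In the obstructed case of [tetra_labels] the pair [a, b] occurs in all three splittings, so by
    the parallelogram law [a ** b] contains [x'^2], [y^2] and [t^2]. Two of these coincide, which
    yields an element of square [e] and hence a diagonal pair. *)
Lemma tetra x' y t z w p p' s s' :
  x' ** y = sym2 z w -> y ** t = sym2 p p' -> x' ** t = sym2 s s' ->
  exists q0 q1 q2 q3, [/\ z ** t = sym2 q0 q1, w ** t = sym2 q2 q3,
    x' ** p = sym2 q0 q2, x' ** p' = sym2 q1 q3 &
    (y ** s = sym2 q0 q3 /\ y ** s' = sym2 q1 q2) \/
    (y ** s = sym2 q1 q2 /\ y ** s' = sym2 q0 q3)].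
Proof.
move=> xy yt xt.
have ty : t ** y = sym2 p p' by rewrite commX.
have yx : y ** x' = sym2 z w by rewrite commX.
have tx : t ** x' = sym2 s s' by rewrite commX.
have xy' : x' ** y = sym2 w z by rewrite sym2C.
have yt' : y ** t = sym2 p' p by rewrite sym2C.
have xt' : x' ** t = sym2 s' s by rewrite sym2C.
have yx' : y ** x' = sym2 w z by rewrite sym2C.
have ty' : t ** y = sym2 p' p by rewrite sym2C.
have [a [b zt]] := sym2_exists (z ** t); have [c [d wt]] := sym2_exists (w ** t).
have [a' [b' xp]] := sym2_exists (x' ** p); have [c' [d' xp']] := sym2_exists (x' ** p').
have [g [k ys]] := sym2_exists (y ** s); have [g' [k' ys']] := sym2_exists (y ** s').
have hB := quad_assoc xy yt zt wt xp xp'.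
have hC := quad_assoc yx xt zt wt ys ys'.
have := tv_meet yx yt; rewrite zt xp => mAB.
have := tv_meet yx' yt; rewrite wt xp => mA'B.
have := tv_meet xy xt; rewrite zt ys => mAC.
have := tv_meet xy' xt; rewrite wt ys => mA'C.
have := tv_meet ty tx; rewrite commX xp ys => mBC.
have := tv_meet ty' tx; rewrite commX xp' ys => mB'C.
rewrite ys'; apply: tetra_labels => // AB AC.
have [abE _] := parallelogram zt.
have abx : exists r, a ** b = sym2 (sq x') r.
  by case: AB => /tvmul_sym2 ->;
    [exists (sq p); rewrite (parallelogram xp).1|exists (sq p'); rewrite (parallelogram xp').1].
have aby : exists r, a ** b = sym2 (sq y) r.
  by case: AC => /tvmul_sym2 ->;
    [exists (sq s); rewrite (parallelogram ys).1|exists (sq s'); rewrite (parallelogram ys').1].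
have abt : exists r, a ** b = sym2 (sq t) r by exists (sq z); rewrite abE sym2C.
case: abx aby abt => [r1 ->] [r2 E2] [r3 E3].
have [E|[E|E]] : sq x' = sq y \/ sq x' = sq t \/ sq y = sq t.
  case/sym2_eqP: E2 => -[E4 E5]; first by left.
  by case/sym2_eqP: E3 => -[E6 E7]; right; [left|right; rewrite -E5].
- have [z2|w2] := sq_eq_mem xy E.
    by left; apply: double_square zt.
  by right; apply: double_square wt.
- apply: (split_diag hC AC); have [s2|s2] := sq_eq_mem xt E.
    by left; rewrite commX in ys; apply: double_square ys.
  by right; rewrite commX in ys'; apply: double_square ys'.
- apply: (split_diag hB AB); have [p2|p2] := sq_eq_mem yt E.
    by left; rewrite commX in xp; apply: double_square xp.
  by right; rewrite commX in xp'; apply: double_square xp'.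
Qed.

(* In the model, with [b], [c] over [y], [t]: [p = b + c], [p' = b - c], [q = a + b + c],
   [q1 = a + b - c], [q2 = a - b - c], [q3 = a - b + c], [m = 2a + b + c]. *)
Definition tvconfig y z t s p q := exists p' q1 q2 q3 m,
  [/\ y ** t = sym2 p p', x0 ** p = sym2 q q2, x0 ** p' = sym2 q1 q3,
      z ** t = sym2 q q1 & [/\ y ** s = sym2 q q3, x0 ** q = sym2 p m & z ** s = sym2 m p']].

(** * Existence of the sum of two pairs *)

Lemma sq_x_neq : sq x0 <> e.
Proof. by move=> x2; apply: x04; rewrite x2 sq_e. Qed.

Lemma sq_diag p q : x0 ** p = sym2 q q -> sq p = e.
Proof.
move=> xp; have [] := parallelogram xp.
by rewrite tv_sq => /sym2_eqP[[/esym/sq_x_neq]|[]].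
Qed.

(** Multiplication by [x0^2 + e] separates points: if [p <> p'], then [x0^2 ** p = [p', p']] and
    [x0^2 ** p' = [p, p]], and the parallelogram law gives [x0^4 = p^2 = e]. *)
Lemma sq_add_inj p p' a b a' b' :
  sq x0 ** p = sym2 a b -> sq x0 ** p' = sym2 a' b' ->
  (forall f, f p *+ 2 + f a + f b = f p' *+ 2 + f a' + f b') -> p = p'.
Proof.
move=> ab ab' H; apply: contrapT => /eqP pp.
have [a'p b'p] : a' = p /\ b' = p.
  have := H (ind1 p); rewrite ind1_id (ind1_neq (_ : p' != p)) 1?eq_sym //.
  by rewrite /ind1; case: (a =P p); case: (b =P p); case: (a' =P p); case: (b' =P p) => //; lia.
have [ap bp] : a = p' /\ b = p'.
  have := H (ind1 p'); rewrite ind1_id (ind1_neq pp).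
  rewrite /ind1; case: (a =P p'); case: (b =P p'); case: (a' =P p'); case: (b' =P p') => //; lia.
rewrite ap bp in ab; rewrite a'p b'p in ab'.
have [+ _] := parallelogram ab; have [+ _] := parallelogram ab'.
rewrite !tv_sq => /sym2_eqP[[/esym/x04]|[p'2 _]] // /sym2_eqP[[/esym/x04]|[]] //.
by rewrite -p'2 => _ pe; apply: x04; rewrite pe.
Qed.

(** The same for [x0^2 - e], the square of [a - a^-1]; it allows this factor to be cancelled. *)
Lemma sq_sub_inj p p' a b a' b' :
  sq x0 ** p = sym2 a b -> sq x0 ** p' = sym2 a' b' ->
  (forall f, f a + f b + f p' *+ 2 = f a' + f b' + f p *+ 2) -> p = p'.
Proof.
move=> ab ab' H; apply: contrapT => /eqP pp.
have [a'p b'p] : a = p /\ b = p.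
  have := H (ind1 p); rewrite ind1_id (ind1_neq (_ : p' != p)) 1?eq_sym //.
  rewrite /ind1; case: (a =P p); case: (b =P p); case: (a' =P p); case: (b' =P p) => //; lia.
rewrite a'p b'p in ab; have [+ _] := parallelogram ab.
rewrite tv_sq => /sym2_eqP[[/esym/x04]|[p2 E]] //.
by apply: x04; rewrite -E -p2.
Qed.

Lemma edge_inj p p' : x0 ** p = x0 ** p' -> p = p'.
Proof.
move=> E; have [q [q' xp]] := sym2_exists (x0 ** p).
have [a [b ab]] := sym2_exists (sq x0 ** p); have [a' [b' ab']] := sym2_exists (sq x0 ** p').
have [c [d xq]] := sym2_exists (x0 ** q); have [c' [d' xq']] := sym2_exists (x0 ** q').
have xp' := xp; rewrite E in xp'; apply: (sq_add_inj ab ab') => f.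
have := quad_assoc (tv_sq x0) xp (tvmulee p) ab xq xq' f.
have := quad_assoc (tv_sq x0) xp' (tvmulee p') ab' xq xq' f.
by lia.
Qed.

(** Only [z ** s] is missing. Two tetrahedra leave [[p, m1]], respectively [[p, m3]], as the
    alternative to [[m, p']]. If both alternatives hold, [m1 = m3], hence [q1 = q3] and
    [p'^2 = e]. *)
Lemma config_generic y z t s w s' p p' q0 q1 q2 q3 :
  x0 ** y = sym2 z w -> x0 ** t = sym2 s s' -> sq p' <> e ->
  y ** t = sym2 p p' -> z ** t = sym2 q0 q1 -> x0 ** p = sym2 q0 q2 ->
  x0 ** p' = sym2 q1 q3 -> y ** s = sym2 q0 q3 -> tvconfig y z t s p q0.
Proof.
move=> xy xt p'2 yt zt xp xp' ys; have [m xq0] := tv_rot xp.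
have [m1 xq1] := tv_rot xp'.
have [m3 xq3] : exists m, x0 ** q3 = sym2 p' m by apply: (tv_rot (w := q1)); rewrite sym2C.
have [y1 xz] := tv_rot xy; have [t1 xs] := tv_rot xt.
have h1 : z ** s = sym2 m p' \/ z ** s = sym2 p m1.
  have [n0 [n1 [n2 [n3]]]] := tetra xz zt xt; rewrite yt xq0 xq1 => -[e1 _ e2 e3 e4].
  by apply: (fold_labels e1 e2 e3); tauto.
have h2 : z ** s = sym2 m p' \/ z ** s = sym2 p m3.
  have [n0 [n1 [n2 [n3]]]] := tetra xy ys xs; rewrite yt xq0 xq3 => -[e1 _ e2 e3 [] [e4 _]].
    apply: (@fold_labels _ p p' m m3 n0 n3 n2 n1) => //; first by rewrite [RHS]sym2C.
    by left.
  apply: (@fold_labels _ p p' m m3 n2 n1 n0 n3) => //; rewrite 1?[RHS]sym2C //.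
  by right; rewrite sym2C.
have zs : z ** s = sym2 m p'.
  case: h1 => // z1; case: h2 => // z2.
  have m13 : m1 = m3 by move: z2; rewrite z1 => /sym2_injr.
  have q13 : q1 = q3 by apply: edge_inj; rewrite xq1 xq3 m13.
  by case: p'2; apply: (sq_diag (q := q1)); rewrite xp' q13.
by exists p', q1, q2, q3, m.
Qed.

(* Here [c] is [h + b] or [h - b], and the labels given by [tetra] may mistake [b + c] for
   [b - c]; the sum is written down explicitly. *)
Lemma config_special y z t s w s' h k :
  x0 ** y = sym2 z w -> x0 ** t = sym2 s s' -> y ** t = sym2 h k -> sq h = e ->
  exists p q, tvconfig y z t s p q.
Proof.
move=> xy xt yt h2; have tE : t = tvtr h y by exact: tvtr_mem yt.
rewrite {}tE in xt yt *.
have [x1 yz] : exists x1, y ** z = sym2 x0 x1 by apply: (tv_rot (w := w)); rewrite commX.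
have [x2 yw] : exists x2, y ** w = sym2 x0 x2.
  by apply: (tv_rot (w := z)); rewrite commX sym2C.
have y2x : sq y ** x0 = sym2 x1 x2.
  have [c [d cd]] := sym2_exists (sq y ** x0).
  have yx : y ** x0 = sym2 z w by rewrite commX.
  rewrite cd; apply: sum_sym2 => f.
  by have := quad_assoc (tv_sq y) yx (tvmulee x0) cd yz yw f; lia.
have tr a b c d : a ** b = sym2 c d -> a ** tvtr h b = sym2 (tvtr h c) (tvtr h d).
  by move=> ab; rewrite commX; apply: tvtrM => //; rewrite commX.
have xh : x0 ** h = sym2 (tvtr h x0) (tvtr h x0) by rewrite commX tvtrE.
have xhy2 : x0 ** tvtr h (sq y) = sym2 (tvtr h x1) (tvtr h x2).
  by apply: tr; rewrite commX.
have yhy : y ** tvtr h y = sym2 h (tvtr h (sq y)) by rewrite (tr _ _ _ _ (tv_sq y)) tvtr_e.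
have zhy : z ** tvtr h y = sym2 (tvtr h x0) (tvtr h x1) by apply: tr; rewrite commX.
have : sym2 s s' = sym2 (tvtr h z) (tvtr h w) by rewrite -xt; apply: tr.
move=> /sym2_eqP[[-> _]|[-> _]].
(* Here [c = h + b], so [b + c = h + 2b] and [a + b + c = h + a + 2b]; in the model [x1] is the
   class of [a + 2b]. *)
- exists (tvtr h (sq y)), (tvtr h x1).
  exists h, (tvtr h x0), (tvtr h x2), (tvtr h x0), (tvtr h (sq z)); split=> //.
  + by rewrite sym2C.
  + by rewrite sym2C.
  + split.
    * by rewrite (tr _ _ _ _ yz) sym2C.
    * by apply: tr; exact: (parallelogram yz).1.
    * by rewrite (tr _ _ _ _ (tv_sq z)) tvtr_e // sym2C.
(* Here [c = h - b], so [b + c = h] and [a + b + c = h + a]. *)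
- exists h, (tvtr h x0).
  exists (tvtr h (sq y)), (tvtr h x1), (tvtr h x0), (tvtr h x2), (tvtr h (sq x0)); split=> //.
  split; first exact: tr.
    by rewrite (tr _ _ _ _ (tv_sq x0)) tvtr_e.
  by apply: tr; exact: (parallelogram xy).1.
Qed.

Lemma config_exists y z t s w s' : x0 ** y = sym2 z w -> x0 ** t = sym2 s s' ->
  exists p q, tvconfig y z t s p q.
Proof.
move=> xy xt; have [p [p' yt]] := sym2_exists (y ** t).
have [p2|/eqP p2] := eqVneq (sq p) e; first exact: config_special xy xt yt p2.
have yt' := yt; rewrite sym2C in yt'.
have [p'2|/eqP p'2] := eqVneq (sq p') e; first exact: config_special xy xt yt' p'2.
have [q0 [q1 [q2 [q3 [zt wt xp xp' [] [ys ys']]]]]] := tetra xy yt xt.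
  by exists p, q0; exact: (config_generic xy xt p'2 yt zt xp xp' ys).
(* In the other orientation the names of [b + c] and [b - c] are exchanged. *)
exists p', q1; apply: (config_generic (p' := p) (q2 := q3) (q3 := q2) xy xt p2 yt' _ _ xp) => //.
by rewrite zt sym2C.
Qed.

(** * Operator matrices of pairs *)

Lemma tvconvD y f g u : tvconv y (fun v => f v + g v) u = tvconv y f u + tvconv y g u.
Proof. exact: big_split. Qed.

Lemma tvconvN y f u : tvconv y (fun v => - f v) u = - tvconv y f u.
Proof. exact: sumrN. Qed.

Lemma tvconv0 y u : tvconv y (fun=> 0) u = 0.
Proof. exact: big1. Qed.

Lemma tvconv_el f u : tvconv e f u = f u *+ 2.
Proof. by rewrite (tvconvE _ (tvmulee u)). Qed.

Lemma tvconv_quad y t z w p p' f u : x0 ** y = sym2 z w -> y ** t = sym2 p p' ->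
  tvconv z (tvconv t f) u + tvconv w (tvconv t f) u =
  tvconv x0 (tvconv p f) u + tvconv x0 (tvconv p' f) u.
Proof.
move=> xy yt; rewrite -(tvconvM _ _ xy) -tvconvD; congr tvconv.
by apply/funext => v; exact: tvconvM.
Qed.

(* The matrix [[z, y], [-y, -w]] of convolution operators: the group element [b] with
   [y = [b]], [z = [a + b]], [w = [a - b]] acts by it, up to the common factor [a - a^-1]. *)
Definition tvmx z y w (F : (X -> int) * (X -> int)) : (X -> int) * (X -> int) :=
  (fun u => tvconv z F.1 u + tvconv y F.2 u,
   fun u => - tvconv y F.1 u - tvconv w F.2 u).

Lemma tvmxM z y w s t s' F : tvmx z y w (tvmx s t s' F) =
  (fun u => tvconv z (tvconv s F.1) u + tvconv z (tvconv t F.2) u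
            - tvconv y (tvconv t F.1) u - tvconv y (tvconv s' F.2) u,
   fun u => - tvconv y (tvconv s F.1) u - tvconv y (tvconv t F.2) u
            + tvconv w (tvconv t F.1) u + tvconv w (tvconv s' F.2) u).
Proof.
by rewrite /tvmx /=; congr pair; apply/funext => u; rewrite !tvconvD !tvconvN; lia.
Qed.

(** The off-diagonal entries agree because [z t + w t] and [s y + s' y] are both [x0 y t]. *)
Lemma tvmxC z y w s t s' F : x0 ** y = sym2 z w -> x0 ** t = sym2 s s' ->
  tvmx z y w (tvmx s t s' F) = tvmx s t s' (tvmx z y w F).
Proof.
move=> xy xt; have E G u : tvconv z (tvconv t G) u + tvconv w (tvconv t G) u =
    tvconv s (tvconv y G) u + tvconv s' (tvconv y G) u.
  rewrite -(tvconvM _ _ xy) -(tvconvM _ _ xt); congr tvconv.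
  by apply/funext => v; exact: tvconvC.
rewrite !tvmxM; congr pair; apply/funext => u.
  have := E F.2 u; rewrite (tvconvC s z) (tvconvC y t) (tvconvC w t) (tvconvC y s').
  by lia.
have := E F.1 u; rewrite (tvconvC y t) (tvconvC w s') (tvconvC s y) (tvconvC z t).
by rewrite (tvconvC w t) (tvconvC s' y); lia.
Qed.

(** The matrix [tvmx x0 e x0] belongs to the neutral element, so this says that [(p, q)] acts as the
    product of the two operators. The products [w ** t] and [y ** s'] follow by associativity; that
    of [w] and [s'] is found only as an operator. *)
Lemma tvmx_config y z w t s s' p q r F :
  x0 ** y = sym2 z w -> x0 ** t = sym2 s s' -> x0 ** p = sym2 q r -> tvconfig y z t s p q ->
  tvmx z y w (tvmx s t s' F) = tvmx x0 e x0 (tvmx q p r F).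
Proof.
move=> xy xt xpr [p' [q1 [q2 [q3 [m [yt xp xp' zt [ys xq zs]]]]]]].
have -> : r = q2 by move: xpr; rewrite xp => /sym2_injr.
have wt : w ** t = sym2 q2 q3.
  have [a [b ab]] := sym2_exists (w ** t); rewrite ab; apply: sum_sym2 => f.
  by have := quad_assoc xy yt zt ab xp xp' f; lia.
have ty : t ** y = sym2 p p' by rewrite commX.
have tw : t ** w = sym2 q2 q3 by rewrite commX.
have sy : s ** y = sym2 q q3 by rewrite commX.
have ys' : y ** s' = sym2 q1 q2.
  rewrite commX; have [a [b ab]] := sym2_exists (s' ** y).
  rewrite ab; apply: sum_sym2 => f.
  by have := quad_assoc xt ty sy ab xp xp' f; lia.
have ws' G u : tvconv w (tvconv s' G) u =
    tvconv x0 (tvconv q2 G) u - tvconv x0 (tvconv q G) u + tvconv z (tvconv s G) u.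
  have := tvconv_quad G u xy ys; have := tvconv_quad G u xt tw.
  by rewrite (tvconvC w s) (tvconvC w s'); lia.
rewrite !tvmxM; congr pair; apply/funext => u; rewrite !tvconv_el.
  rewrite (tvconvM _ _ zs) (tvconvM _ _ zt) (tvconvM _ _ yt) (tvconvM _ _ ys').
  by rewrite (tvconvM _ _ xq) (tvconvM _ _ xp); lia.
rewrite ws' (tvconvM _ _ zs) (tvconvM _ _ ys) (tvconvM _ _ yt) (tvconvM _ _ wt).
by rewrite (tvconvM _ _ xp) (tvconvM _ _ xq); lia.
Qed.

(** By the parallelogram law, [z w - y y = (x0^2 + y^2) - (e + y^2) = x0^2 - e]. *)
Lemma tvmx_opp y z w F : x0 ** y = sym2 z w ->
  tvmx z y w (tvmx w y z F) = tvmx x0 e x0 (tvmx x0 e x0 F).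
Proof.
move=> xy; have [zw _] := parallelogram xy; have wz := zw; rewrite commX in wz.
rewrite !tvmxM; congr pair; apply/funext => u; rewrite !tvconv_el.
all: rewrite ?(tvconvM _ _ zw) ?(tvconvM _ _ wz) !(tvconvM _ _ (tv_sq _)) !tvconv_el.
all: by rewrite ?(tvconvC _ y) ?(tvconvC _ e) ?tvconv_el; lia.
Qed.

Lemma tvmx_inj y z w y' z' w' :
  (forall F, tvmx x0 e x0 (tvmx x0 e x0 (tvmx z y w F)) =
             tvmx x0 e x0 (tvmx x0 e x0 (tvmx z' y' w' F))) -> y = y' /\ z = z'.
Proof.
move=> H; have [a [b xz]] := sym2_exists (sq x0 ** z).
have [a' [b' xz']] := sym2_exists (sq x0 ** z').
have [c [d xy]] := sym2_exists (sq x0 ** y).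
have [c' [d' xy']] := sym2_exists (sq x0 ** y').
have zx := xz; have zx' := xz'; have yx := xy; have yx' := xy'.
rewrite commX in zx; rewrite commX in zx'; rewrite commX in yx; rewrite commX in yx'.
have {}H f : (tvconv z f (sq x0) - f z *+ 2 = tvconv z' f (sq x0) - f z' *+ 2) /\
             (tvconv y f (sq x0) - f y *+ 2 = tvconv y' f (sq x0) - f y' *+ 2).
  (* The first column, evaluated at [e], suffices; [tvmx x0 e x0] squares to multiplication by
     [x0^2 - e]. *)
  have := H (f, fun=> 0); rewrite ![tvmx x0 e x0 (tvmx x0 e x0 _)]tvmxM => -[].
  move=> /(congr1 (@^~ e)) E1 /(congr1 (@^~ e)) E2; move: E1 E2 => /=.
  rewrite !(tvconvM _ _ (tv_sq _)) !tvconv_el !tvconv_e !tvconv0.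
  by rewrite !sq_e !tvconv_e !tvconv_el !tvconv0; lia.
split.
  apply: (sq_sub_inj xy xy') => f; have [_] := H f.
  by rewrite (tvconvE _ yx) (tvconvE _ yx'); lia.
apply: (sq_sub_inj xz xz') => f; have [+ _] := H f.
by rewrite (tvconvE _ zx) (tvconvE _ zx'); lia.
Qed.

(** Replacing [c] by [-c] exchanges [s] and [s']; thus the classes of [b + c] and [b - c] are the
    two values of [y ** t], as the coset product requires. *)
Lemma tvconfig_opp y z t s s' p q : x0 ** t = sym2 s s' -> tvconfig y z t s p q ->
  exists p' q', tvconfig y z t s' p' q' /\ y ** t = sym2 p p'.
Proof.
move=> xt [p' [q1 [q2 [q3 [m [yt xp xp' zt [ys xq zs]]]]]]].
exists p', q1; split=> //; have [m1 xq1] := tv_rot xp'.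
have ty : t ** y = sym2 p p' by rewrite commX.
have tz : t ** z = sym2 q q1 by rewrite commX.
have sy : s ** y = sym2 q q3 by rewrite commX.
have sz : s ** z = sym2 m p' by rewrite commX.
exists p, q, q3, q2, m1; split=> //.
- by rewrite sym2C.
- by rewrite sym2C.
- split=> //.
    rewrite commX; have [a [b ab]] := sym2_exists (s' ** y).
    rewrite ab; apply: sum_sym2 => f.
    by have := quad_assoc xt ty sy ab xp xp' f; lia.
  rewrite commX; have [a [b ab]] := sym2_exists (s' ** z).
  rewrite ab; apply: sum_sym2 => f.
  by have := quad_assoc xt tz sz ab xq xq1 f; lia.
Qed.

End Algebra.

(** * Powers and orders *)

Section Order.
Variable X : twoValuedGroupType.
Hypotheses (involX : tv_involutive X) (commX : tv_commutative X).

Lemma tvpow_sq (x : X) : tvpow x 2 = sq x.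
Proof.
have [p0 p1 pS] := tvpowP involX x; have [+ _] := pS 1%N isT.
by rewrite /= p0 p1 => /(sq_uniq involX commX).
Qed.

Lemma tvpow_sq_sq (x : X) : tvpow x 4 = sq (sq x).
Proof.
have [p0 p1 pS] := tvpowP involX x.
have [+ _] := pS 2%N isT; have [+ _] := pS 3%N isT; rewrite /= p1 tvpow_sq => x3 x2.
apply: eq_of_fun => f.
have := quad_assoc (tv_sq involX commX x) x2 (tvmulee _) (tv_sq involX commX (sq x))
  (tv_sq involX commX x) x3 f.
by lia.
Qed.

Lemma tvord_sq_sq (x : X) :
  tvord x <> Some 1%N -> tvord x <> Some 2%N -> tvord x <> Some 4%N -> sq (sq x) <> tve.
Proof.
move=> n1 n2 n4; rewrite -tvpow_sq_sq => x4.
move: n1 n2 n4; rewrite /tvord; case: pselect => [ex|[]]; last first.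
  by exists 4%N; rewrite x4 eqxx.
case: ex_minnP => -[|[|[|[|[|k]]]]] // /andP[_ /eqP pk] min _ _ _; last first.
  by have := min 4%N; rewrite x4 eqxx => /(_ isT).
(* Only order 3 remains: [x ** x^2 = [x, e]] gives [x^2 = x], and then [x ** x^3 = [x^2, x^4]] reads
   [[x, x] = [x, e]]. *)
have [p0 p1 pS] := tvpowP involX x.
have := (pS 2%N isT).1; rewrite /= pk p1 sym2C => /(tve_eq involX) xx.
have := (pS 3%N isT).1; rewrite /= pk x4 (tvmule x).2 -xx => /sym2_injr xe.
by have := min 1%N; rewrite p1 xe eqxx => /(_ isT).
Qed.

End Order.

(** * Limits along ultrafilters *)

Local Open Scope classical_set_scope.

Lemma continuous_at_ultra (T U : topologicalType) (f : T -> U) (t : T) :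
  (forall G : set_system T, UltraFilter G -> G --> t -> f @ G --> f t) -> f @ t --> f t.
Proof.
move=> h V fV; apply: contrapT => nV.
pose H := within (~` (f @^-1` V)) (nbhs t).
have FH : ProperFilter H.
  apply: Build_ProperFilter_ex => P HP; apply: contrapT => nP; apply: nV.
  have tP : nbhs t [set u | ~ V (f u) -> P u] := HP.
  apply: (@filterS _ (nbhs t) _ _ _ _ tP) => u /= Pu; apply: contrapT => nu.
  by apply: nP; exists u; exact: Pu.
have [G [GU HG]] := ultraFilterLemma FH.
have Gt : G --> t by move=> P tP; apply: HG; exact: filterS tP.
have GV : G (f @^-1` V) by exact: (h G GU Gt V fV).
have GnV : G (~` (f @^-1` V)) by apply: HG; exact: withinT.
by have [u []] := filter_ex (filterI GV GnV).
Qed.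

Lemma sym2_nbhs (X : topologicalType) (a b : X) (U V : set X) :
  nbhs a U -> nbhs b V ->
  nbhs (sym2 a b) [set p | exists u v, [/\ p = sym2 u v, U u & V v]].
Proof.
rewrite !nbhsE => -[U' [oU U'a] UU] [V' [oV V'b] VV].
have oX (A B : set X) : open A -> open B -> open (A `*` B).
  move=> oA oB; apply: openI; apply: open_comp => // c _; [exact: cvg_fst|exact: cvg_snd].
exists [set p | exists u v, [/\ p = sym2 u v, U' u & V' v]]; last first.
  by move=> _ [u [v [-> Uu Vv]]]; exists u, v; split=> //; [exact: UU|exact: VV].
split; last by exists a, b.
rewrite /open /= /quotient_open.
rewrite (_ : _ @^-1` _ = (U' `*` V') `|` (V' `*` U')).
  by apply: openU; exact: oX.
apply/seteqP; split=> [[c d] /= [u [v [/sym2_eqP[[-> ->]|[-> ->]] Uu Vv]]]|[c d] /= [[]|[]]].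
- by left.
- by right.
- by move=> Uc Vd; exists c, d.
- by move=> Vc Ud; exists d, c; split=> //; exact: sym2C.
Qed.

(* An ultrafilter decides which of the two coordinates tends to which limit. *)
Lemma ultra_sym2 (T : Type) (X : topologicalType) (G : set_system T) (u v : T -> X) a b :
  UltraFilter G -> (fun i => sym2 (u i) (v i)) @ G --> sym2 a b ->
  (u @ G --> a /\ v @ G --> b) \/ (u @ G --> b /\ v @ G --> a).
Proof.
move=> GU uv; apply: contrapT => /not_orP[n1 n2].
have sep (c d : X) : ~ (u @ G --> c /\ v @ G --> d) ->
    exists U V, [/\ nbhs c U, nbhs d V & ~ G (u @^-1` U `&` v @^-1` V)].
  move=> /not_andP[] /existsNP[W] /not_implyP[Wc nW].
    exists W, setT; split=> //; first exact: filterT.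
    by apply: contra_not nW => GW; apply: (@filterS _ G _ _ _ _ GW) => i [].
  exists setT, W; split=> //; first exact: filterT.
  by apply: contra_not nW => GW; apply: (@filterS _ G _ _ _ _ GW) => i [].
have [U1 [V1 [U1a V1b nG1]]] := sep _ _ n1.
have [V2 [U2 [V2b U2a nG2]]] := sep _ _ n2.
have Ua : nbhs a (U1 `&` U2) by exact: filterI.
have Vb : nbhs b (V1 `&` V2) by exact: filterI.
have := uv _ (sym2_nbhs Ua Vb); rewrite nbhs_simpl /=.
have [//|Gn] := in_ultra_setVsetC (u @^-1` U1 `&` v @^-1` V1) GU.
move=> /(filterI Gn) GG; apply: nG2; apply: filterS GG => i /= [ni].
move=> [u' [v' [/sym2_eqP[[<- <-]|[<- <-]] [? ?] [? ?]]]]; last by split.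
by case: ni.
Qed.

(** The branches [r] and [r'] are arbitrary selections; their convergence is part of the
    conclusion. *)
Lemma ultra_tvmul (T : Type) (X : topTwoValuedGroupType) (G : set_system T)
  (u v r r' : T -> X) (a b : X) : UltraFilter G -> u @ G --> a -> v @ G --> b ->
  (forall i, u i ** v i = sym2 (r i) (r' i)) ->
  exists c c', [/\ a ** b = sym2 c c', r @ G --> c & r' @ G --> c'].
Proof.
move=> GU ua vb uv; have [c [c' ab]] := sym2_exists (a ** b).
have : (fun i => sym2 (r i) (r' i)) @ G --> sym2 c c'.
  rewrite -ab (_ : (fun i => _) = (fun p : X * X => p.1 ** p.2) \o (fun i => (u i, v i))).
    by apply: cvg_comp; [exact: cvg_pair ua vb|exact: (tvmul_continuous (a, b))].
  by apply/funext => i; rewrite /= uv.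
move=> /(ultra_sym2 GU)[[]|[]] ? ?; first by exists c, c'.
by exists c', c; split=> //; rewrite sym2C.
Qed.

(** * The double cover *)

Local Open Scope quotient_scope.

(* The hypotheses are phantom arguments, on which the group and topological structures depend. *)
Definition tvcover (X : topTwoValuedGroupType) (x : X) of tv_involutive X
  & tv_commutative X & hausdorff_space X & sq (sq x) <> tve : Type :=
  {b : X * X | b.2 \in elts (x ** b.1)}.

Section Cover.
Variables (X : topTwoValuedGroupType) (x : X).
Hypotheses (involX : tv_involutive X) (commX : tv_commutative X).
Hypotheses (hausX : hausdorff_space X) (x4 : sq (sq x) <> tve).
Implicit Types (y z t : X).

Local Notation A := (tvcover involX commX hausX x4).
Local Notation cval := (val : {b : X * X | b.2 \in elts (x ** b.1)} -> X * X).

HB.instance Definition _ := Choice.copy A {b : X * X | b.2 \in elts (x ** b.1)}.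
HB.instance Definition _ := Topological.copy A (initial_topology cval).

Implicit Types (b c d : A).

(** In the model, [cover_base], [cover_up] and [cover_dn] are the classes of [b], [a + b] and
    [a - b]; negation exchanges the last two. *)
Definition cover_base b : X := (cval b).1.
Definition cover_up b : X := (cval b).2.
Definition cover_dn b : X := sval (cid (sym2_mem (valP b))).

Lemma coverE b : x ** cover_base b = sym2 (cover_up b) (cover_dn b).
Proof. exact: svalP (cid (sym2_mem (valP b))). Qed.

Lemma cover_mem y z w : x ** y = sym2 z w -> (y, z).2 \in elts (x ** (y, z).1).
Proof. by move=> /= ->; rewrite mem_sym2 eqxx. Qed.

Definition mkcover y z w (xy : x ** y = sym2 z w) : A := Sub (y, z) (cover_mem xy).

Lemma cover_eq b c : cover_base b = cover_base c -> cover_up b = cover_up c -> b = c.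
Proof.
case: b c => [[y z] yz] [[y' z'] yz']; rewrite /cover_base /cover_up /= => yy zz.
by apply: val_inj; rewrite /= yy zz.
Qed.

Lemma cover_dn_eq b w : x ** cover_base b = sym2 (cover_up b) w -> cover_dn b = w.
Proof. by rewrite coverE => /sym2_injr. Qed.

(** * The group law on the cover *)

Definition cover_mx b := tvmx (cover_up b) (cover_base b) (cover_dn b).

Lemma xe : x ** tve = sym2 x x. Proof. exact: (tvmule x).2. Qed.

Definition cover0 : A := mkcover xe.

Lemma cover0_mx F : cover_mx cover0 F = tvmx x tve x F.
Proof. by rewrite /cover_mx (cover_dn_eq (w := x)) // xe. Qed.

Lemma cover_mx_inj b c :
  (forall F, tvmx x tve x (tvmx x tve x (cover_mx b F)) =
             tvmx x tve x (tvmx x tve x (cover_mx c F))) -> b = c.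
Proof. by move=> /(tvmx_inj involX commX x4)[]; exact: cover_eq. Qed.

Lemma cover_add_ex b c : exists d, tvconfig x (cover_base b) (cover_up b)
  (cover_base c) (cover_up c) (cover_base d) (cover_up d).
Proof.
have [p [q cf]] := config_exists involX commX x4 (coverE b) (coverE c).
by have [p' [q1 [q2 [q3 [m [_ xp _ _ _]]]]]] := cf; exists (mkcover xp).
Qed.

(** The choice is harmless: by [config_mx] and [cover_add_uniq], every configuration over [b] and
    [c] gives the same element. *)
Definition cover_add b c : A := sval (cid (cover_add_ex b c)).

Lemma cover_addP b c : tvconfig x (cover_base b) (cover_up b)
  (cover_base c) (cover_up c) (cover_base (cover_add b c)) (cover_up (cover_add b c)).
Proof. exact: svalP (cid (cover_add_ex b c)). Qed.

Lemma config_mx b c d F : tvconfig x (cover_base b) (cover_up b)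
    (cover_base c) (cover_up c) (cover_base d) (cover_up d) ->
  cover_mx b (cover_mx c F) = tvmx x tve x (cover_mx d F).
Proof. exact: (tvmx_config commX F (coverE b) (coverE c) (coverE d)). Qed.

Lemma cover_add_mx b c F :
  tvmx x tve x (cover_mx (cover_add b c) F) = cover_mx b (cover_mx c F).
Proof. by rewrite (config_mx _ (cover_addP b c)). Qed.

Lemma cover_add_uniq b c d :
  (forall F, cover_mx b (cover_mx c F) = tvmx x tve x (cover_mx d F)) ->
  cover_add b c = d.
Proof. by move=> h; apply: cover_mx_inj => F; rewrite cover_add_mx h. Qed.

Lemma cover_addC : commutative cover_add.
Proof.
move=> b c; apply: cover_add_uniq => F; rewrite cover_add_mx.
exact: (tvmxC commX _ (coverE b) (coverE c)).
Qed.

Lemma cover_addA : associative cover_add.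
Proof.
move=> b c d; apply: cover_mx_inj => F.
(* The operator of [b] is moved out past the common factor, which then meets that of [c + d]. *)
rewrite !cover_add_mx -(tvmxC commX _ (coverE b) xe) -/(cover_mx b).
by rewrite !cover_add_mx.
Qed.

Lemma cover_add0 : left_id cover0 cover_add.
Proof. by move=> b; apply: cover_add_uniq => F; rewrite cover0_mx. Qed.

Lemma cover_swap b : x ** cover_base b = sym2 (cover_dn b) (cover_up b).
Proof. by rewrite coverE sym2C. Qed.

Definition cover_opp b : A := mkcover (cover_swap b).

Lemma cover_opp_dn b : cover_dn (cover_opp b) = cover_up b.
Proof. by apply: cover_dn_eq; exact: (cover_swap b). Qed.

Lemma cover_addN : left_inverse cover0 cover_opp cover_add.
Proof.
move=> b; rewrite cover_addC; apply: cover_add_uniq => F.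
rewrite cover0_mx /cover_mx cover_opp_dn.
exact: (tvmx_opp involX commX x4 F (coverE b)).
Qed.

HB.instance Definition _ :=
  GRing.isZmodule.Build A cover_addA cover_addC cover_add0 cover_addN.

(** * Topology of the cover *)

Lemma cover_base_continuous : continuous cover_base.
Proof.
move=> b; apply: (@cvg_comp _ _ _ (cval : A -> X * X) fst _ (nbhs (cval b))).
  exact: (@initial_continuous _ _ cval b).
exact: cvg_fst.
Qed.

Lemma cover_up_continuous : continuous cover_up.
Proof.
move=> b; apply: (@cvg_comp _ _ _ (cval : A -> X * X) snd _ (nbhs (cval b))).
  exact: (@initial_continuous _ _ cval b).
exact: cvg_snd.
Qed.

Lemma cvg_cover (T : Type) (G : set_system T) (u : T -> A) b : Filter G ->
  cover_base \o u @ G --> cover_base b -> cover_up \o u @ G --> cover_up b -> u @ G --> b.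
Proof.
move=> FG hb hu U [_ [[W oW <-] Wb] WU].
have bu : (fun i => cval (u i)) @ G --> cval b.
  rewrite (surjective_pairing (cval b)) (_ : (fun i => _) =
    fun i => ((cover_base \o u) i, (cover_up \o u) i)); first exact: cvg_pair hb hu.
  by apply/funext => i; rewrite /= -surjective_pairing.
have GW : G (u @^-1` (cval @^-1` W)) by apply: bu; exact: open_nbhs_nbhs.
by apply: (@filterS _ G _ _ _ _ GW) => i; exact: WU.
Qed.

Lemma cover_hausdorff : hausdorff_space A.
Proof.
move=> b c bc; apply: cover_eq; apply: hausX => U V bU cV.
  have [d []] := bc _ _ (cover_base_continuous bU) (cover_base_continuous cV).
  by exists (cover_base d).
have [d []] := bc _ _ (cover_up_continuous bU) (cover_up_continuous cV).
by exists (cover_up d).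
Qed.

(** The relations provide limits of all labels in turn; Hausdorff separation makes the limits of one
    label in different relations agree. *)
Lemma ultra_config (T : Type) (G : set_system T) (y z t s p q : T -> X) (y0 z0 t0 s0 : X) :
  UltraFilter G -> y @ G --> y0 -> z @ G --> z0 -> t @ G --> t0 -> s @ G --> s0 ->
  (forall i, tvconfig x (y i) (z i) (t i) (s i) (p i) (q i)) ->
  exists p0 q0, [/\ p @ G --> p0, q @ G --> q0 & tvconfig x y0 z0 t0 s0 p0 q0].
Proof.
move=> GU yG zG tG sG /choice[p'] /choice[q1] /choice[q2] /choice[q3] /choice[m] cf.
have lim_uniq (u : T -> X) (c c' : X) : u @ G --> c -> u @ G --> c' -> c' = c.
  by move=> h h'; apply: (cvg_unique hausX h' h).
have xG : (fun=> x) @ G --> x by exact: cvg_cst.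
have cf1 i := let: And5 h _ _ _ _ := cf i in h.
have cf2 i := let: And5 _ h _ _ _ := cf i in h.
have cf3 i := let: And5 _ _ h _ _ := cf i in h.
have cf4 i := let: And5 _ _ _ h _ := cf i in h.
have cf5 i := let: And5 _ _ _ _ (And3 h _ _) := cf i in h.
have cf6 i := let: And5 _ _ _ _ (And3 _ h _) := cf i in h.
have cf7 i := let: And5 _ _ _ _ (And3 _ _ h) := cf i in h.
have [p0 [p'0 [yt pG p'G]]] := ultra_tvmul GU yG tG cf1.
have [q0 [q20 [xp qG q2G]]] := ultra_tvmul GU xG pG cf2.
have [q10 [q30 [xp' q1G q3G]]] := ultra_tvmul GU xG p'G cf3.
have [? [? [zt /(lim_uniq _ _ _ qG) qE /(lim_uniq _ _ _ q1G) q1E]]] :=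
  ultra_tvmul GU zG tG cf4.
have [? [? [ys /(lim_uniq _ _ _ qG) qE' /(lim_uniq _ _ _ q3G) q3E]]] :=
  ultra_tvmul GU yG sG cf5.
have [? [m0 [xq /(lim_uniq _ _ _ pG) pE mG]]] := ultra_tvmul GU xG qG cf6.
have [? [? [zs /(lim_uniq _ _ _ mG) mE /(lim_uniq _ _ _ p'G) p'E]]] :=
  ultra_tvmul GU zG sG cf7.
subst; exists p0, q0; split=> //.
by exists p'0, q10, q20, q30, m0; split.
Qed.

Lemma cover_add_continuous : continuous (fun u : A * A => u.1 + u.2).
Proof.
move=> [b c]; apply: continuous_at_ultra => G GU Gbc.
have bG : fst @ G --> b by apply: cvg_trans (cvg_app fst Gbc) _; exact: cvg_fst.
have cG : snd @ G --> c by apply: cvg_trans (cvg_app snd Gbc) _; exact: cvg_snd.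
have lim (f : A -> X) (g : A * A -> A) d : continuous f -> g @ G --> d -> f \o g @ G --> f d.
  by move=> cf gG; apply: cvg_comp gG _; exact: cf.
have [p [q [pG qG cf]]] := ultra_config GU
  (lim _ _ _ cover_base_continuous bG) (lim _ _ _ cover_up_continuous bG)
  (lim _ _ _ cover_base_continuous cG) (lim _ _ _ cover_up_continuous cG)
  (fun u : A * A => cover_addP u.1 u.2).
have [p' [q1 [q2 [q3 [m [_ xp _ _ _]]]]]] := cf.
have -> : b + c = mkcover xp :> A.
  by apply: cover_add_uniq => F; exact: config_mx.
exact: cvg_cover.
Qed.

Lemma cover_opp_continuous : continuous (-%R : A -> A).
Proof.
move=> b; apply: continuous_at_ultra => G GU Gb.
have bG : cover_base @ G --> cover_base b := cvg_trans (cvg_app _ Gb) (@cover_base_continuous b).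
have uG : cover_up @ G --> cover_up b := cvg_trans (cvg_app _ Gb) (@cover_up_continuous b).
have xG : (fun=> x) @ G --> x by exact: cvg_cst.
(* The limit of [cover_up] is known, so [w] must be the other value over [b]. *)
have [z [w [xb zG wG]]] := ultra_tvmul GU xG bG coverE.
have zE : z = cover_up b by apply: (cvg_unique hausX zG uG).
apply: cvg_cover => //.
by rewrite /= /cover_up /= (cover_dn_eq (w := w)) // xb zE.
Qed.

HB.instance Definition _ :=
  PreTopologicalNmodule_isTopologicalNmodule.Build A cover_add_continuous.
HB.instance Definition _ :=
  TopologicalNmodule_isTopologicalZmodule.Build A cover_opp_continuous.

(** * The isomorphism with the antipodal coset group *)

Let Atop : topologicalZmodType := A.

Lemma cover_base_eq b c : cover_base b = cover_base c -> b = c \/ b = - c.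
Proof.
move=> bc; have := coverE b; rewrite bc coverE => /sym2_eqP[[u _]|[_ u]].
  by left; apply: cover_eq.
by right; apply: cover_eq; rewrite // -u.
Qed.

(** A section chosen without regard to continuity; only its class up to sign matters. *)
Definition cover_lift y : A := mkcover (sym2_repr (x ** y)).

Lemma cover_lift_base y : cover_base (cover_lift y) = y.
Proof. by []. Qed.

Definition cover_class y : tvcoset (antipodal Atop) := coset_pi (antipodal Atop) (cover_lift y).

Lemma cover_class_base b : cover_class (cover_base b) = coset_pi (antipodal Atop) b.
Proof.
apply/eqP; rewrite eq_coset_pi.
have [<-|->] := cover_base_eq (cover_lift_base (cover_base b)); first by rewrite eqxx.
by rewrite /= opprK eqxx orbT.
Qed.

Definition coset_base (p : tvcoset (antipodal Atop)) : X := cover_base (repr p).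

Lemma coset_base_pi b : coset_base (coset_pi (antipodal Atop) b) = cover_base b.
Proof. by rewrite /coset_base; case: (repr_coset_pi (antipodal Atop) b) => ->. Qed.

(** Along an ultrafilter the lifts converge to some point over the limit, and its class does not
    depend on which one. *)
Lemma cover_class_continuous : continuous cover_class.
Proof.
move=> y; apply: continuous_at_ultra => G GU Gy.
have xG : (fun=> x) @ G --> x by exact: cvg_cst.
have [z [w [xy zG _]]] := ultra_tvmul GU xG Gy (fun y => coverE (cover_lift y)).
rewrite (cover_class_base (mkcover xy)).
apply: (@cvg_comp _ _ _ cover_lift (coset_pi (antipodal Atop)) _ (nbhs (mkcover xy))).
  exact: cvg_cover.
exact: coset_pi_continuous.
Qed.

Lemma coset_base_continuous : continuous coset_base.
Proof.
have [_] := @quotient_continuous _ {eq_quot (orbit_equiv (antipodal Atop))} _ coset_base.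
apply; rewrite (_ : _ \o _ = cover_base); first exact: cover_base_continuous.
by apply/funext => b; exact: coset_base_pi.
Qed.

Lemma cover_class_iso : tv_isomorphism cover_class.
Proof.
split.
  exists coset_base; last by split; [exact: cover_class_continuous|exact: coset_base_continuous].
  split=> [y|p]; first exact: coset_base_pi.
  by elim/coset_ind: p => b; rewrite coset_base_pi cover_class_base.
move=> y t z1 z2 yt; have -> : cover_class y ** cover_class t =
  coset_mul (cover_class y) (cover_class t) by [].
rewrite coset_mulE /=; set b := cover_lift y; set c := cover_lift t.
have [p' [q' [cf bc]]] := tvconfig_opp involX commX (coverE c) (cover_addP b c).
have [? [? [? [? [? [_ xp _ _ _]]]]]] := cf.
have -> : b - c = mkcover xp.
  by apply: cover_add_uniq => F; exact: config_mx.
rewrite -2!cover_class_base; move: bc; rewrite [_ ** _]yt.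
by move=> /sym2_eqP[[-> ->]|[-> ->]] //; exact: sym2C.
Qed.

End Cover.

Theorem theorem14p2 (X : topTwoValuedGroupType)
    (involX : tv_involutive X) (commX : tv_commutative X)
    (hausX : hausdorff_space X)
    (exX : exists x : X,
      [/\ tvord x <> Some 1%N, tvord x <> Some 2%N & tvord x <> Some 4%N]) :
  exists A : topologicalZmodType,
    hausdorff_space A /\ tv_isomorphic X (tvcoset (antipodal A)).
Proof.
have [x [n1 n2 n4]] := exX.
have x4 := tvord_sq_sq involX commX n1 n2 n4.
exists (tvcover involX commX hausX x4); split; first exact: cover_hausdorff.
by exists (@cover_class _ _ involX commX hausX x4); exact: cover_class_iso.
Qed.
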